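(* Let $\Phi:\mathbb{R}^n\times\mathbb{R}^n\to\mathbb{R}^n$ be smooth and such that $\Phi(x,t)$ is linear in $t$. For $x,t\in\mathbb{R}^n$ let $J_\Phi(x,t)$ be the absolute value of the determinant of the linear map $\mathbb{R}^n\to\mathbb{R}^n$, $u\mapsto (u\cdot\nabla_x)\Phi(x,t)$. Suppose that there is a finite bound $N$ such that for every fixed $t\in\mathbb{R}^n$ and every $c\in\mathbb{R}^n$, the equation $\Phi(x,t)=c$ has at most $N$ solutions $x\in\mathbb{R}^n$ with $J_\Phi(x,t)\ne 0$. Suppose also that for each $\theta\in[0,1)$ there is a constant $C_\theta$ such that \[ \big|\{t\in[-1,1]^n : J_\Phi(x,t)\le\epsilon\}\big|\le C_\theta\,\epsilon^\theta \] for all $x\in\mathbb{R}^n$ and all $\epsilon>0$, where $|\cdot|$ denotes Lebesgue measure. Then the operator \[ Tf(x,x'):=\int_{[-1,1]^n} f\big(x+t,\;x'+\Phi(x,t)\big)\,dt,\qquad (x,x')\in\mathbb{R}^n\times\mathbb{R}^n, \] maps $L^p(\mathbb{R}^{2n})$ boundedly to $L^q(\mathbb{R}^{2n})$ for all pairs $(\frac1p,\frac1q)$ on the line segment between $(\frac23,\frac13)$ and $(0,0)$, except possibly the endpoint $(\frac23,\frac13)$. *)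

(* Defs.v *)
From HB Require Import structures.
From mathcomp Require Import all_boot all_order all_algebra.
From mathcomp Require Import all_classical all_reals all_analysis.

Set Implicit Arguments.
Unset Strict Implicit.
Unset Printing Implicit Defensive.

Import Order.TTheory GRing.Theory Num.Theory.
Import numFieldNormedType.Exports.

Local Open Scope classical_set_scope.
Local Open Scope ring_scope.

Fact rV_display : measure_display. Proof. by []. Qed.

Section rV_measurable.
Context (R : realType) (n : nat).

(* The sigma-algebra generated by the coordinate functions, that is, the Borel
   sigma-algebra of R^n. *)
Definition rV_measurable : set (set 'rV[R]_n) :=
  g_sigma_preimage
    (fun (i : 'I_n) (v : 'rV[R]_n) => v ord0 i : measurableTypeR R).

Let rV_set0 : rV_measurable set0.
Proof. exact: sigma_algebra0. Qed.

Let rV_setC A : rV_measurable A -> rV_measurable (~` A).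
Proof. exact: sigma_algebraC. Qed.

Let rV_bigcup (F : (set 'rV[R]_n)^nat) :
  (forall i, rV_measurable (F i)) -> rV_measurable (\bigcup_i F i).
Proof. exact: sigma_algebra_bigcup. Qed.

HB.instance Definition _ := @isMeasurable.Build rV_display 'rV[R]_n
  rV_measurable rV_set0 rV_setC rV_bigcup.

Lemma measurable_coord (i : 'I_n) :
  measurable_fun setT (fun v : 'rV[R]_n => v ord0 i : measurableTypeR R).
Proof.
move=> _ Y mY; rewrite setTI; apply: sub_sigma_algebra => /=.
rewrite -bigcup_seq/=; exists i => /=; first by rewrite mem_index_enum.
by exists Y => //; rewrite setTI.
Qed.

Lemma measurable_rVP d (T : measurableType d) (f : T -> 'rV[R]_n) :
  (forall i, measurable_fun setT (fun x => f x ord0 i : measurableTypeR R)) ->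
  measurable_fun setT f.
Proof.
move=> mf.
suff h : g_sigma_preimage (fun (i : 'I_n) x => f x ord0 i : measurableTypeR R)
    `<=` measurable.
  move=> _ A mA; apply: h.
  by rewrite (g_sigma_preimage_comp (fun (i : 'I_n) (v : 'rV[R]_n) =>
    v ord0 i : measurableTypeR R) f); exists A.
apply: smallest_sub; first exact: sigma_algebra_measurable.
rewrite -bigcup_seq; apply: bigcup_sub => i _ A [B mB <-].
exact: mf.
Qed.

End rV_measurable.

Section lebesgue_rV.
Context (R : realType).

Definition rV_cons n (z : measurableTypeR R * 'rV[R]_n) : 'rV[R]_n.+1 :=
  \row_(i < n.+1) oapp (fun j : 'I_n => z.2 ord0 j) z.1 (unlift ord0 i).

Definition rV_uncons n (v : 'rV[R]_n.+1) : measurableTypeR R * 'rV[R]_n :=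
  (v ord0 ord0, \row_(j < n) v ord0 (lift ord0 j)).

Lemma rV_unconsK n : cancel (@rV_uncons n) (@rV_cons n).
Proof.
move=> v; apply/rowP => i; rewrite mxE.
by case: unliftP => [j ->|->] //=; rewrite mxE.
Qed.

Lemma rV_consK n : cancel (@rV_cons n) (@rV_uncons n).
Proof.
move=> [x v]; rewrite /rV_uncons; congr (_, _).
  by rewrite mxE unlift_none.
by apply/rowP => j; rewrite !mxE liftK.
Qed.

Lemma measurable_rV_cons n : measurable_fun setT (@rV_cons n).
Proof.
apply: measurable_rVP => i; case: (unliftP ord0 i) => [j ->|->].
  under eq_fun do rewrite mxE liftK.
  exact: (measurableT_comp (measurable_coord j) measurable_snd).
by under eq_fun do rewrite mxE unlift_none; exact: measurable_fst.
Qed.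

Lemma measurable_rV_uncons n : measurable_fun setT (@rV_uncons n).
Proof.
apply/measurable_fun_pairP; split; first exact: measurable_coord.
apply: measurable_rVP => i /=.
by under eq_fun do rewrite mxE; exact: measurable_coord.
Qed.

Section step.
Context n (m : {sigma_finite_measure set 'rV[R]_n -> \bar R}).

Definition lebesgue_rVS := pushforward (@lebesgue_measure R \x m)%E (@rV_cons n).

Let measurable_preimage A :
  measurable A -> measurable (@rV_cons n @^-1` A).
Proof. by move=> mA; rewrite -[X in measurable X]setTI; exact: measurable_rV_cons. Qed.

Let lebesgue_rVS0 : lebesgue_rVS set0 = 0%E.
Proof. by rewrite /lebesgue_rVS /pushforward preimage_set0 measure0. Qed.

Let lebesgue_rVS_ge0 A : (0 <= lebesgue_rVS A)%E.
Proof. exact: (measure_ge0 (@lebesgue_measure R \x m)%E). Qed.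

Let lebesgue_rVS_sigma_additive : semi_sigma_additive lebesgue_rVS.
Proof.
move=> F mF tF mUF; rewrite /lebesgue_rVS /pushforward preimage_bigcup.
apply: measure_semi_sigma_additive.
- by move=> k; exact: measurable_preimage.
- apply/trivIsetP => /= i j _ _ ij; rewrite -preimage_setI.
  by move/trivIsetP : tF => /(_ _ _ _ _ ij) ->//; rewrite preimage_set0.
- by rewrite -preimage_bigcup; exact: measurable_preimage.
Qed.

HB.instance Definition _ := isMeasure.Build _ _ _ lebesgue_rVS
  lebesgue_rVS0 lebesgue_rVS_ge0 lebesgue_rVS_sigma_additive.

Lemma lebesgue_rVS_sigma_finite : sigma_finite setT lebesgue_rVS.
Proof.
have /sigma_finiteP[F [FT ndF mF]] := sigma_finiteT (@lebesgue_measure R).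
have /sigma_finiteP[G [GT ndG mG]] := sigma_finiteT m.
exists (fun k => @rV_uncons n @^-1` (F k `*` G k)).
  apply/esym/seteqP; split=> // v _.
  have [a _ Fa] : (\bigcup_i F i) (@rV_uncons n v).1 by rewrite -FT.
  have [b _ Gb] : (\bigcup_i G i) (@rV_uncons n v).2 by rewrite -GT.
  exists (maxn a b) => //; split.
    by move: Fa; exact/subsetPset/ndF/leq_maxl.
  by move: Gb; exact/subsetPset/ndG/leq_maxr.
move=> k; have [mFk Fkoo] := mF k; have [mGk Gkoo] := mG k; split.
  rewrite -[X in measurable X]setTI; apply: measurable_rV_uncons => //.
  exact: measurableX.
rewrite /lebesgue_rVS /pushforward -comp_preimage.
rewrite (_ : _ \o _ = id); last by apply/funext => z; exact: rV_consK.
by rewrite preimage_id product_measure1E// lte_mul_pinfty// ge0_fin_numE.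
Qed.

HB.instance Definition _ :=
  Measure_isSigmaFinite.Build _ _ _ lebesgue_rVS lebesgue_rVS_sigma_finite.

End step.

(* n-dimensional Lebesgue measure on the Borel sets, as an iterated product;
   R^0 is a point of mass 1. *)
Fixpoint lebesgue_rV n : {sigma_finite_measure set 'rV[R]_n -> \bar R} :=
  match n with
  | 0 => dirac (0 : 'rV[R]_0)
  | n'.+1 => lebesgue_rVS (lebesgue_rV n')
  end.

End lebesgue_rV.

Lemma lebesgue_rV_box (R : realType) n (A : 'I_n -> set R) :
  (forall i, measurable (A i : set (measurableTypeR R))) ->
  lebesgue_rV R n [set v | forall i, A i (v ord0 i)] =
  (\prod_(i < n) lebesgue_measure (A i))%E.
Proof.
elim: n A => [|n IH] A mA.
  rewrite big_ord0 /= diracE mem_set//=; by case.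
rewrite big_ord_recl/= /lebesgue_rVS /pushforward.
rewrite (_ : _ @^-1` _ = A ord0 `*`
    [set v : 'rV[R]_n | forall i, A (lift ord0 i) (v ord0 i)]); last first.
  apply/seteqP; split=> -[x v] /=.
    move=> h; split=> [|i]; first by have := h ord0; rewrite mxE unlift_none.
    by have := h (lift ord0 i); rewrite mxE liftK.
  by move=> [Ax Av] i; rewrite mxE; case: unliftP => [j ->|->] /=.
rewrite product_measure1E//; first by rewrite (IH (fun i => A (lift ord0 i))).
rewrite (_ : mkset _ = \bigcap_(i in [set: 'I_n])
    ((fun v : 'rV[R]_n => v ord0 i) @^-1` A (lift ord0 i))).
  apply: fin_bigcap_measurable => // i _.
  rewrite -[X in measurable X]setTI.
  exact: (@measurable_coord R n i measurableT _ (mA _)).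
by apply/seteqP; split=> v /= h i => [_|]; [exact: h|exact: (h i I)].
Qed.

Section smooth.
Context (R : realType) (V W : normedModType R).

(* For finite-dimensional V this is the usual class C^k: continuity of
   x |-> 'd f x is equivalent to that of x |-> 'd f x v for every v. *)
Fixpoint class_C (k : nat) (f : V -> W) : Prop :=
  match k with
  | 0 => continuous f
  | k'.+1 => (forall x, differentiable f x) /\
             (forall v, class_C k' (fun x => 'd f x v))
  end.

Definition smooth (f : V -> W) := forall k, class_C k f.

End smooth.

Section averaging_operator.
Context (R : realType) (n : nat).
Implicit Types (Phi : 'rV[R]_n * 'rV[R]_n -> 'rV[R]_n) (x t : 'rV[R]_n).

Definition cube : set 'rV[R]_n := [set t | forall i, -1 <= t ord0 i <= 1].

Definition JPhi Phi x t : R := `| \det ('J (fun y => Phi (y, t)) x) |.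

Definition shear Phi (z : 'rV[R]_n * 'rV[R]_n) t : 'rV[R]_n * 'rV[R]_n :=
  (z.1 + t, z.2 + Phi (z.1, t)).

Definition averaging Phi (f : 'rV[R]_n * 'rV[R]_n -> R)
    (z : 'rV[R]_n * 'rV[R]_n) : R :=
  \int[lebesgue_rV R n]_(t in cube) f (shear Phi z t).

(* Lebesgue measure on R^2n, identified with R^n x R^n. *)
Definition lebesgue_rV2 :
    {measure set ('rV[R]_n * 'rV[R]_n)%type -> \bar R} :=
  (lebesgue_rV R n \x lebesgue_rV R n)%E.

(* Functions are real-valued representatives of elements of L^p. The operator
   averaging is total (Rintegral of a non-integrable function is a default
   value), hence the first conjunct: the defining integral converges for
   almost every (x, x'). *)
Definition averaging_bounded Phi (p q : \bar R) : Prop :=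
  exists C : R, forall f, f \in Lfun lebesgue_rV2 p ->
    [/\ {ae lebesgue_rV2, forall z,
           (lebesgue_rV R n).-integrable cube (fun t => (f (shear Phi z t))%:E)},
        averaging Phi f \in Lfun lebesgue_rV2 q &
        ('N[lebesgue_rV2]_q[EFin \o averaging Phi f]
           <= C%:E * 'N[lebesgue_rV2]_p[EFin \o f])%E].

End averaging_operator.

(* Main.v *)
Require Import Defs.
From HB Require Import structures.
From mathcomp Require Import all_boot all_order all_algebra fingroup perm.
From mathcomp Require Import all_classical all_reals all_analysis.
From mathcomp Require Import measurable_realfun ess_sup_inf.
From mathcomp Require Import ring lra.

(* Write q = m + 1 = 2p with m > 2, and f_t for the value of |f| at the point
   sheared by t from z = (x, x').  Two applications of Hölder's inequality give,
   pointwise in z,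
     (∫ f_t dt)^(m+1) <= C ∫∫ f_s^p f_t^p J(x, t - s) ds dt,
   because the power -1/(m-1) > -1 of the weight J(x, t - s) is integrable in t,
   uniformly in x and s: this is the sublevel hypothesis, which survives the
   shift by s since J(x, .) is homogeneous and (t - s)/2 stays in the cube.
   Now integrate over z.  By linearity of Phi in t, moving the base point to
   w = z + (s, Phi(x, s)) turns the second factor into the value of |f|^p at
   w + (u, Phi(x, u)) with u = t - s.  For fixed w and u the integral over x
   against J(x, u) is a change of variables y = Phi(x, u) of multiplicity at
   most N, so that the total is at most C' N (∫ |f|^p)^2.  When p = q = +oo it
   suffices that almost every sheared cube meets a null set in a null set. *)

Set Implicit Arguments.
Unset Strict Implicit.
Unset Printing Implicit Defensive.

Import Order.TTheory GRing.Theory Num.Theory.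
Import numFieldNormedType.Exports.

Local Open Scope classical_set_scope.
Local Open Scope ring_scope.

(** * Dyadic grids *)

Section countable_valued.

(** The sublevel bound of order [theta] controls the integral of [J^(-delta)] through a dyadic
    series that converges for [delta < theta]. With every [theta < 1] available this covers
    [delta = 1/(m-1)] as soon as [m > 2]; the excluded endpoint [p = 3/2] would be [m = 2], that is
    [delta = 1]. The change of variables is proved as an inequality with constant [2^(n+1) N], which
    is all that boundedness requires. The obstacle is that [x |-> Phi (x, u)] need not be injective
    and degenerates where [J = 0]. There the weight kills the integrand, and the rest is exhausted
    by dyadic cells on which the map, followed by the inverse of its Jacobian [L] at a nearby point,
    shrinks distances by at most a factor 2. On such a cell one only needs that sets of small
    diameter have small measure; disjointness of the cells turns the bound [N] on fibres into a
    bound on the overlap of their images. Lebesgue measure being an iterated product, measures are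
    compared on dyadic cells, whose mass is explicit, and the comparison is then carried to all
    Borel sets. *)

Lemma measurable_preimage_countType d (T : measurableType d) (C : countType)
    (h : T -> C) :
  (forall c, measurable (h @^-1` [set c])) ->
  forall B : set C, measurable (h @^-1` B).
Proof.
move=> mh B.
rewrite (_ : h @^-1` B = \bigcup_(c in B) (h @^-1` [set c])).
  rewrite bigcup_mkcond; apply: countable_bigcupT_measurable.
    exact: countableP.
  by move=> c; case: ifPn => _; [exact: mh|exact: measurable0].
by apply/seteqP; split => [x Bx|x [c Bc hx]]; [exists (h x)|rewrite /preimage/= hx].
Qed.

Lemma measure_partition_nat d (T : measurableType d) (R : realType)
    (mu : {measure set T -> \bar R}) (h : T -> nat) (A : set T) :
  (forall B : set nat, measurable (h @^-1` B)) -> measurable A ->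
  mu A = (\sum_(j <oo) mu (A `&` h @^-1` [set j]))%E.
Proof.
move=> mh mA; rewrite -measure_semi_bigcup.
- by congr (mu _); apply/seteqP; split => [x Ax|x [j _ []]//]; exists (h x).
- by move=> j; exact: measurableI.
- by move=> i j _ _ [x [[_ /= <-] [_ /= <-]]].
- by apply: bigcup_measurable => j _; exact: measurableI.
Qed.

End countable_valued.

Section dyadic_grid.
Context (R : realType).

Definition grid n (k : nat) (v : 'rV[R]_n) : 'rV[int]_n :=
  \row_i Num.floor (2 ^+ k * v ord0 i).

(** Indexing the cells by [nat] makes the measure of a set a series over cells; an index that
    encodes no cell has empty preimage. *)
Definition gridn n k (v : 'rV[R]_n) : nat := pickle (grid k v).

Definition grid_point n k (v : 'rV[R]_n) : 'rV[R]_n :=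
  \row_i ((grid k v ord0 i)%:~R / 2 ^+ k).

Lemma gridn_eq n k (v w : 'rV[R]_n) :
  (gridn k v = gridn k w) <-> (grid k v = grid k w).
Proof. by rewrite /gridn; split => [/(pcan_inj (@pickleK _))//|->]. Qed.

Let exp2_gt0 k : 0 < 2 ^+ k :> R. Proof. exact: exprn_gt0. Qed.

Lemma grid_eqP n k (v : 'rV[R]_n) (z : 'rV[int]_n) :
  (grid k v = z) <-> (forall i, (z ord0 i)%:~R / 2 ^+ k <= v ord0 i <
                                (z ord0 i + 1)%:~R / 2 ^+ k).
Proof.
split=> [<- i|vz].
  rewrite mxE ler_pdivrMr// ltr_pdivlMr// ![_ * 2 ^+ k]mulrC.
  exact: floor_itv.
apply/rowP => i; rewrite mxE; apply/eqP; rewrite floor_eq.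
by have := vz i; rewrite ler_pdivrMr// ltr_pdivlMr// ![_ * 2 ^+ k]mulrC.
Qed.

Lemma grid_cell n k (z : 'rV[int]_n) :
  @grid n k @^-1` [set z] = [set v | forall i,
    `[(z ord0 i)%:~R / 2 ^+ k, (z ord0 i + 1)%:~R / 2 ^+ k[%classic (v ord0 i)].
Proof.
apply/seteqP; split => v /=; first by move=> /grid_eqP h i; rewrite in_itv/=.
by move=> h; apply/grid_eqP => i; have := h i; rewrite in_itv.
Qed.

Lemma measurable_rV_box n (A : 'I_n -> set R) :
  (forall i, measurable (A i : set (measurableTypeR R))) ->
  measurable [set v : 'rV[R]_n | forall i, A i (v ord0 i)].
Proof.
move=> mA; rewrite (_ : mkset _ = \bigcap_(i in [set: 'I_n])
    ((fun v : 'rV[R]_n => v ord0 i) @^-1` A i)).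
  apply: fin_bigcap_measurable => // i _.
  rewrite -[X in measurable X]setTI.
  exact: (@measurable_coord R n i measurableT _ (mA _)).
by apply/seteqP; split=> v /= h i => [_|]; [exact: h|exact: (h i I)].
Qed.

Lemma measurable_grid n k (B : set 'rV[int]_n) : measurable (@grid n k @^-1` B).
Proof.
apply: measurable_preimage_countType => z; rewrite grid_cell.
by apply: (measurable_rV_box (A := fun i =>
 `[(z ord0 i)%:~R / 2 ^+ k, (z ord0 i + 1)%:~R / 2 ^+ k[%classic)).
Qed.

Lemma measurable_gridn n k (B : set nat) : measurable (@gridn n k @^-1` B).
Proof. exact: (measurable_grid k (pickle @^-1` B)). Qed.

Lemma lebesgue_rV_itv n (a b : 'I_n -> R) b0 b1: (forall i, a i <= b i) ->
  lebesgue_rV R n [set v | forall i, [set` Interval (BSide b0 (a i)) (BSide b1 (b i))] (v ord0 i)] =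
  (\prod_(i < n) (b i - a i))%:E.
Proof.
move=> ab; rewrite (lebesgue_rV_box (A := fun i =>
  [set` Interval (BSide b0 (a i)) (BSide b1 (b i))])); last first.
  by move=> i; exact: measurable_itv.
rewrite -prodEFin; apply: eq_bigr => i _.
rewrite lebesgue_measure_itv/= lte_fin; case: ltgtP (ab i) => // ->.
by rewrite subrr.
Qed.

Lemma lebesgue_rV_cube n (w : 'I_n -> R) (r : R) : 0 <= r ->
  lebesgue_rV R n [set v | forall i, w i <= v ord0 i < w i + r] = (r ^+ n)%:E.
Proof.
move=> r0; transitivity (lebesgue_rV R n [set v | forall i,
    `[w i, w i + r[%classic (v ord0 i)]).
  by congr (lebesgue_rV R n _); apply/seteqP; split => v /= h i; have := h i;
    rewrite in_itv.
rewrite lebesgue_rV_itv; last by move=> i; rewrite lerDl.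
congr (_%:E); rewrite (eq_bigr (fun=> r)) ?prodr_const ?card_ord// => i _.
by rewrite [X in X - _]addrC addrK.
Qed.

Lemma lebesgue_grid_cell n k (z : 'rV[int]_n) :
  lebesgue_rV R n (@grid n k @^-1` [set z]) = ((2 ^- k) ^+ n)%:E.
Proof.
rewrite grid_cell lebesgue_rV_itv; last first.
  by move=> i; rewrite ler_pM2r ?invr_gt0// ler_int lerDl.
congr (_%:E); rewrite (eq_bigr (fun=> 2 ^- k)) ?prodr_const ?card_ord// => i _.
by rewrite -mulrBl intrD [X in X - _]addrC addrK mul1r.
Qed.

(** Dyadic intervals are nested: [z <= 2^j u] says the same as [z 2^(k-j) <= 2^k u], a condition
    with an integer on the left, so the finer floor decides it. *)
Lemma grid_coarsen n j k (v w : 'rV[R]_n) : (j <= k)%N ->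
  grid k v = grid k w -> grid j v = grid j w.
Proof.
move=> jk vw; have vwi i : Num.floor (2 ^+ k * v ord0 i) = Num.floor (2 ^+ k * w ord0 i).
  by move/rowP : vw => /(_ i); rewrite !mxE.
apply/rowP => i; rewrite !mxE; apply/eqP; rewrite eq_le.
have key (x y : R) : Num.floor (2 ^+ k * x) = Num.floor (2 ^+ k * y) ->
    (Num.floor (2 ^+ j * x) <= Num.floor (2 ^+ j * y))%R.
  move=> xy; rewrite floor_ge_int.
  have h (u : R) (z : int) : (z%:~R <= 2 ^+ j * u) =
      ((z * 2 ^+ (k - j))%:~R <= 2 ^+ k * u).
    rewrite -[in X in _ = (_ <= X)](subnK jk) exprD intrM rmorphXn/= [z%:~R * _]mulrC.
    by rewrite -mulrA ler_pM2l// exprn_gt0.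
  rewrite h -floor_ge_int -xy floor_ge_int -h; exact: floor_le.
by rewrite !key.
Qed.

Lemma grid_point_dist n k (v : 'rV[R]_n) : `|grid_point k v - v| <= 2 ^- k.
Proof.
rewrite [leLHS]/Num.Def.normr /= mx_normrE; apply/bigmax_leP; split=> /=.
  by rewrite invr_ge0 exprn_ge0.
move=> [i j] _ /=; rewrite ord1 !mxE.
have /grid_eqP/(_ j) : grid k v = grid k v by []; rewrite mxE.
move: (Num.floor _) => z; rewrite intrD mulrDl mul1r => /andP[h1 h2].
by rewrite ler_norml; apply/andP; split; lra.
Qed.

Lemma grid_point_cvg n (v : 'rV[R]_n) : grid_point k v @[k --> \oo] --> v.
Proof.
apply/cvgrPdist_lt => e e0.
near=> k; rewrite distrC (le_lt_trans (grid_point_dist k v))//.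
rewrite -[ltLHS]mul1r; near: k.
exact: (near_infty_natSinv_expn_lt (PosNum e0)).
Unshelve. all: by end_near. Qed.

(** With cells as generators, a property of Borel sets can be proved by checking it on unions of
    cells of one level and closing under the operations of a sigma-algebra. *)
Lemma measurable_rV_grid n : @measurable _ 'rV[R]_n =
  <<s [set A | exists k B, A = @grid n k @^-1` B] >>.
Proof.
apply/seteqP; split; last first.
  apply: smallest_sub; first exact: sigma_algebra_measurable.
  by move=> _ [k [B ->]]; exact: measurable_grid.
set G := (X in <<s X >>).
pose f (i : 'I_n) (v : g_sigma_algebraType G) : measurableTypeR R :=
  (v : 'rV[R]_n) ord0 i.
have mf i : measurable_fun setT (f i).
  apply: (measurability _ (RGenCInfty.measurableE R)) => _ [_ [a ->] <-].
  (* A half-line is cut out by comparing floors at every level: if the coordinate lies below [a] by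
     more than [2^-k], then [2^k] times it is below [2^k a - 1], hence below the floor of
     [2^k a]. *)
  rewrite setTI (_ : _ @^-1` _ = \bigcap_k (@grid n k @^-1`
     [set z | (Num.floor (2 ^+ k * a) <= z ord0 i)%R])).
    apply: bigcap_measurable => [|k _]; first by exists 0%N.
    by apply: sub_sigma_algebra; eexists; eexists.
  apply/seteqP; split => v; rewrite /f /= in_itv/= andbT.
    by move=> av k _ /=; rewrite mxE le_floor// ler_pM2l.
  move=> h; rewrite leNgt; apply/negP => va.
  have d0 : 0 < a - v ord0 i by rewrite subr_gt0.
  have [k _ /(_ k (leqnn _))/=] := near_infty_natSinv_expn_lt (PosNum d0).
  rewrite ltr_pdivrMr// => dk.
  have := h k I; rewrite /= mxE floor_ge_int.
  have := floor_itv (2 ^+ k * a); rewrite intrD; move: dk.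
  by move: (Num.floor _)%:~R => z; nra.
apply: smallest_sub; first exact: smallest_sigma_algebra.
move=> A; rewrite -bigcup_seq => -[i _ [B mB <-]].
exact: (mf i measurableT B mB).
Qed.

Lemma open_measurable_rV n (U : set 'rV[R]_n) : open U -> measurable U.
Proof.
move=> oU; rewrite (_ : U = \bigcup_k \bigcup_(z in
    [set z | @grid n k @^-1` [set z] `<=` U]) (@grid n k @^-1` [set z])).
  apply: bigcup_measurable => k _.
  rewrite (_ : \bigcup_(_ in _) _ = @grid n k @^-1`
    [set z | @grid n k @^-1` [set z] `<=` U]); first exact: measurable_grid.
  by apply/seteqP; split => [v [z zU vz]|v vU]; [rewrite /preimage/= vz|exists (grid k v)].
apply/seteqP; split => [v Uv|v [k _ [z zU vz]]]; last exact: zU.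
have /nbhs_ballP[e /= e0 eU] : nbhs v U by apply: open_nbhs_nbhs.
have e20 : 0 < e / 2 by rewrite divr_gt0.
have [k _ /(_ k (leqnn _))/= ke] := near_infty_natSinv_expn_lt (PosNum e20).
exists k => //; exists (grid k v) => //= w wv; apply: eU.
rewrite -ball_normE/= -[v - w](subrKA (grid_point k v)).
have -> : grid_point k v = grid_point k w by rewrite /grid_point wv.
rewrite [X in X + _](_ : _ = v - grid_point k v); last by rewrite /grid_point wv.
rewrite (le_lt_trans (ler_normD _ _))// (splitr e) ltrD//.
  by rewrite distrC (le_lt_trans (grid_point_dist k v))// -[ltLHS]mul1r.
by rewrite (le_lt_trans (grid_point_dist k w))// -[ltLHS]mul1r.
Qed.

Lemma closed_measurable_rV n (U : set 'rV[R]_n) : closed U -> measurable U.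
Proof.
by move=> cU; rewrite -[U]setCK; apply: measurableC; apply: open_measurable_rV; exact: closed_openC.
Qed.

(** Evaluating [f] at the corners of the cells that contain a point gives functions that factor
    through a countable set of cells, and these converge pointwise to [f]. This links the product
    topology with the product sigma-algebra. *)
Lemma continuous_measurable_rV2 n m (f : 'rV[R]_n * 'rV[R]_m -> R) :
  continuous f -> measurable_fun setT (f : _ -> measurableTypeR R).
Proof.
move=> cf; pose h k z := f (grid_point k z.1, grid_point k z.2).
have hf (z : 'rV[R]_n * 'rV[R]_m) : h ^~ z @ \oo --> f z.
  apply: (@cvg_comp _ _ _ (fun k => (grid_point k z.1, grid_point k z.2)) f
     _ (nbhs z)); last exact: cf.
  case: z => x y; exact: (cvg_pair (@grid_point_cvg _ x) (@grid_point_cvg _ y)).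
apply: (@measurable_fun_cvg _ _ _ _ h) => [k|z _]; last exact: hf.
move=> _ Y _; rewrite setTI.
pose c (z : 'rV[R]_n * 'rV[R]_m) := (grid k z.1, grid k z.2).
rewrite (_ : _ @^-1` _ = c @^-1` [set p : 'rV[int]_n * 'rV[int]_m |
    Y (f (\row_i ((p.1 ord0 i)%:~R / 2 ^+ k), \row_i ((p.2 ord0 i)%:~R / 2 ^+ k)))]).
  apply: measurable_preimage_countType => -[a b].
  rewrite (_ : _ @^-1` _ = (grid k @^-1` [set a]) `*` (grid k @^-1` [set b])).
    by apply: measurableX; exact: measurable_grid.
  by apply/seteqP; split => -[x y] /=; rewrite /c/= => -[-> ->].
by [].
Qed.

Lemma continuous_measurable_rV n (f : 'rV[R]_n -> R) :
  continuous f -> measurable_fun setT (f : _ -> measurableTypeR R).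
Proof.
move=> cf; pose h k z := f (grid_point k z).
have hf (z : 'rV[R]_n) : h ^~ z @ \oo --> f z.
  exact: (@cvg_comp _ _ _ (fun k => grid_point k z) f _ _ _ (@grid_point_cvg _ z) (cf z)).
apply: (@measurable_fun_cvg _ _ _ _ h) => [k|z _]; last exact: hf.
move=> _ Y _; rewrite setTI.
exact: (measurable_grid k [set p | Y (f (\row_i ((p ord0 i)%:~R / 2 ^+ k)))]).
Qed.

End dyadic_grid.

(** * Comparison of measures on dyadic cells *)

Section grid_comparison.
Context (R : realType) (n : nat).
Implicit Types (mu nu rho : {measure set 'rV[R]_n -> \bar R}).

Let sdiff (A B : set 'rV[R]_n) := (A `\` B) `|` (B `\` A).

Let measurable_sdiff A B : measurable A -> measurable B -> measurable (sdiff A B).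
Proof. by move=> mA mB; apply: measurableU; exact: measurableD. Qed.

(** The approximable sets form a sigma-algebra that contains the generators. Complements keep the
    symmetric difference; for countable unions, finiteness of [rho] and continuity from above make
    the part missed by a finite union small. *)
Lemma grid_approx rho (A : set 'rV[R]_n) : (rho setT < +oo)%E -> measurable A ->
  forall e : R, 0 < e -> exists k (B : set 'rV[int]_n),
    (rho (sdiff A (grid k @^-1` B)) <= e%:E)%E.
Proof.
move=> rhoT mA.
pose G := [set A : set 'rV[R]_n | measurable A /\ forall e : R, 0 < e ->
  exists k (B : set 'rV[int]_n), (rho (sdiff A (grid k @^-1` B)) <= e%:E)%E].
suff : G A by case.
have GU X Y : G X -> G Y -> G (X `|` Y).
  move=> [mX aX] [mY aY]; split; first exact: measurableU.
  move=> e e0; have e20 : 0 < e / 2 by rewrite divr_gt0.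
  have [k [B hB]] := aX _ e20; have [l [C hC]] := aY _ e20.
  pose m := maxn k l.
  (* Both unions of cells are also unions of cells of the finer level [m], namely of those which
     they meet. *)
  exists m, (@grid R n m @` ((grid k @^-1` B) `|` (grid l @^-1` C))).
  rewrite (splitr e) EFinD; apply: le_trans (leeD hB hC).
  apply: le_trans; last first.
    by apply: measureU2; apply: measurable_sdiff => //; exact: measurable_grid.
  apply: le_measure.
  - apply: mem_set; apply: measurable_sdiff; last exact: measurable_grid.
    exact: measurableU.
  - by apply: mem_set; apply: measurableU; apply: measurable_sdiff => //; exact: measurable_grid.
  move=> v [[[Xv|Yv] nv]|[[w [Bw|Cw] wv] nv]].
  - left; left; split => // Bv; apply: nv; exists v => //; by left.
  - right; left; split => // Bv; apply: nv; exists v => //; by right.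
  - left; right; split; last by move=> Xv; apply: nv; left.
    by rewrite /preimage/= -(grid_coarsen (leq_maxl k l) wv).
  - right; right; split; last by move=> Xv; apply: nv; right.
    by rewrite /preimage/= -(grid_coarsen (leq_maxr k l) wv).
move: mA; rewrite measurable_rV_grid; apply: smallest_sub; last first.
  move=> _ [k [B ->]]; split; first exact: measurable_grid.
  move=> e e0; exists k, B.
  by rewrite /sdiff setDv setU0 measure0 lee_fin ltW.
have G0 : G set0.
  split => // e e0; exists 0%N, set0.
  by rewrite /sdiff preimage_set0 setDv setU0 measure0 lee_fin ltW.
split => //.
- move=> X [mX aX]; rewrite setTD; split; first exact: measurableC.
  move=> e /aX[k [B hB]]; exists k, (~` B).
  by rewrite /sdiff preimage_setC !setDE !setCK setIC setUC [X in X `|` _]setIC -!setDE.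
move=> F GF; have mF i : measurable (F i) by case: (GF i).
have mUF : measurable (\bigcup_i F i) by exact: bigcup_measurable.
split => // e e0; have e20 : 0 < e / 2 by rewrite divr_gt0.
pose U N := \big[setU/set0]_(i < N) F i.
have GUN N : G (U N) by rewrite /U; elim/big_ind : _ => // i _; exact: GF.
pose D N := (\bigcup_i F i) `\` U N.
have mD N : measurable (D N) by apply: measurableD => //; case: (GUN N).
have [N DN] : exists N, (rho (D N) < (e / 2)%:E)%E.
  have capD : \bigcap_N D N = set0.
    apply/seteqP; split => // v /= h; have [[i _ Fiv] _] := h 0%N I.
    have [_ []] := h i.+1 I; rewrite /U -bigcup_mkord.
    by exists i => //=.
  have D0 : (rho (D 0%N) < +oo)%E.
    by apply: le_lt_trans rhoT; apply: le_measure; rewrite ?inE.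
  have : rho \o D @ \oo --> rho (\bigcap_N D N).
    apply: nonincreasing_cvg_mu => //; first by rewrite capD.
    move=> i j ij; apply/subsetPset => v [Fv nU]; split => // Uv; apply: nU.
    move: Uv; rewrite /U -!bigcup_mkord => -[l /= li Fl]; exists l => //=.
    exact: leq_trans li ij.
  rewrite capD measure0 => /(_ [set x | (x < (e / 2)%:E)%E]) [].
    by apply: open_ereal_lt'; rewrite lte_fin.
  by move=> N _ /(_ N (leqnn N)) DN; exists N.
have [_ /(_ _ e20)[k [B hB]]] := GUN N.
exists k, B; rewrite (splitr e) EFinD; apply: le_trans (leeD (ltW DN) hB).
have mUN : measurable (U N) by case: (GUN N).
apply: le_trans; last first.
  by apply: measureU2 => //; apply: measurable_sdiff => //; exact: measurable_grid.
apply: le_measure; rewrite ?inE.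
- by apply: measurable_sdiff => //; exact: measurable_grid.
- by apply: measurableU => //; apply: measurable_sdiff => //; exact: measurable_grid.
move=> v [[Fv nB]|[Bv nF]].
  have [Uv|nUv] := pselect (U N v); first by right; left.
  by left.
right; right; split => // Uv; apply: nF.
by move: Uv; rewrite /U -bigcup_mkord => -[i _ Fiv]; exists i.
Qed.

Lemma gridn_cell k j : @gridn R n k @^-1` [set j] = set0 \/
  exists z, @gridn R n k @^-1` [set j] = grid k @^-1` [set z].
Proof.
have [->|/set0P[v <-]] := eqVneq (@gridn R n k @^-1` [set j]) set0; first by left.
by right; exists (grid k v); apply/seteqP; split => w /= /gridn_eq.
Qed.

(* On a cell of side 1 both measures are finite, and there every Borel set is
   approximated in mu + nu by unions of dyadic cells. *)
Lemma le_measure_grid mu nu :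
  (forall z, (mu (grid 0 @^-1` [set z]) < +oo)%E) ->
  (forall k z, (nu (grid k @^-1` [set z]) <= mu (grid k @^-1` [set z]))%E) ->
  forall A, measurable A -> (nu A <= mu A)%E.
Proof.
move=> mufin numu A mA.
have le_grid k (B : set 'rV[int]_n) :
    (nu (grid k @^-1` B) <= mu (grid k @^-1` B))%E.
  rewrite (measure_partition_nat nu (@measurable_gridn R n k)); last first.
    exact: measurable_grid.
  rewrite (measure_partition_nat mu (@measurable_gridn R n k)); last first.
    exact: measurable_grid.
  apply: lee_nneseries => // j _.
  have [->|[z ->]] := gridn_cell k j; first by rewrite setI0 !measure0.
  have [Bz|Bz] := pselect (B z).
    suff -> : @grid R n k @^-1` B `&` @grid R n k @^-1` [set z] = @grid R n k @^-1` [set z] by [].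
    by apply/seteqP; split => v [] // vz; split => //; rewrite /preimage/= vz.
  suff -> : @grid R n k @^-1` B `&` @grid R n k @^-1` [set z] = set0.
    by rewrite !measure0.
  by apply/seteqP; split => v // [Bv vz]; apply: Bz; rewrite -vz.
rewrite (measure_partition_nat nu (@measurable_gridn R n 0))//.
rewrite (measure_partition_nat mu (@measurable_gridn R n 0))//.
apply: lee_nneseries => // j _; set C := _ @^-1` _.
have mC : measurable C by exact: measurable_gridn.
have muC : (mu C < +oo)%E.
  by rewrite /C; have [->|[z ->]] := gridn_cell 0 j; rewrite ?measure0.
have nuC : (nu C < +oo)%E.
  apply: le_lt_trans muC; exact: (le_grid 0%N (pickle @^-1` [set j])).
apply/lee_addgt0Pr => e e0; have e20 : 0 < e / 2 by rewrite divr_gt0.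
pose rho := measure_add (mrestr mu mC) (mrestr nu mC).
have rhoE X : rho X = (mu (X `&` C) + nu (X `&` C))%E.
  by rewrite /rho measure_addE.
have rhoT : (rho setT < +oo)%E.
  by rewrite rhoE !setTI; exact: lte_add_pinfty.
have [k [B hB]] := grid_approx rhoT mA e20.
set G := grid k @^-1` B in hB; have mG : measurable G by exact: measurable_grid.
have [hmu hnu] : (mu (sdiff A G `&` C) <= (e / 2)%:E)%E /\
    (nu (sdiff A G `&` C) <= (e / 2)%:E)%E.
  have {}hB : (rho (sdiff A G) <= (e / 2)%:E)%E := hB.
  by split; apply: le_trans hB; rewrite rhoE;
    [apply: leeDl|apply: leeDr].
have GC : (nu (G `&` C) <= mu (G `&` C))%E.
  (* [C] is a cell of level 0 or empty, hence a union of cells of level [k], and the comparison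
     already known for such unions applies to [G] cut down to [C]. *)
  suff -> : G `&` C = grid k @^-1` (@grid R n k @` (G `&` C)) by exact: le_grid.
  apply/seteqP; split => v; first by exists v.
  move=> [w [Gw Cw] wv]; split; first by rewrite /G /preimage/= -wv.
  by rewrite /C /preimage/= -Cw; apply/gridn_eq; rewrite (grid_coarsen (leq0n k) wv).
have sub (la : {measure set 'rV[R]_n -> \bar R}) X Y :
    measurable X -> measurable Y -> (la (sdiff A G `&` C) <= (e / 2)%:E)%E ->
    X `<=` Y `|` (sdiff A G `&` C) -> (la X <= la Y + (e / 2)%:E)%E.
  move=> mX mY hla XY; apply: le_trans (leeD (le_refl _) hla).
  have mS : measurable (sdiff A G `&` C).
    by apply: measurableI => //; exact: measurable_sdiff.
  apply: le_trans (measureU2 la mY mS).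
  by apply: le_measure; rewrite ?inE//; exact: measurableU.
have h1 : (nu (A `&` C) <= nu (G `&` C) + (e / 2)%:E)%E.
  apply: sub => //; try exact: measurableI.
  move=> v [Av Cv]; have [Gv|nGv] := pselect (G v); first by left.
  by right; split => //; left.
have h2 : (mu (G `&` C) <= mu (A `&` C) + (e / 2)%:E)%E.
  apply: sub => //; try exact: measurableI.
  move=> v [Av Cv]; have [Gv|nGv] := pselect (A v); first by left.
  by right; split => //; right.
have -> : e%:E = ((e / 2)%:E + (e / 2)%:E)%E by rewrite -EFinD -splitr.
apply: (le_trans h1); rewrite addeA leeD//.
exact: le_trans GC h2.
Qed.

Lemma eq_measure_grid mu nu :
  (forall z, (mu (grid 0 @^-1` [set z]) < +oo)%E) ->
  (forall k z, nu (grid k @^-1` [set z]) = mu (grid k @^-1` [set z])) ->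
  forall A, measurable A -> nu A = mu A.
Proof.
move=> mufin numu A mA; apply/eqP; rewrite eq_le.
by rewrite !le_measure_grid//= => *; rewrite numu.
Qed.

End grid_comparison.

(** * Linear images of Lebesgue measure *)

Section preimage_measure.
Context (R : realType).
Local Open Scope ereal_scope.

Lemma preimage_measure_le n d (T : measurableType d) (mu : {measure set T -> \bar R})
    (f : T -> 'rV[R]_n) (c : R) :
  measurable_fun setT f -> (0 <= c)%R ->
  (forall k z, mu (f @^-1` (@grid R n k @^-1` [set z])) <= (c * 2 ^- k ^+ n)%:E) ->
  forall A, measurable A -> mu (f @^-1` A) <= c%:E * lebesgue_rV R n A.
Proof.
move=> mf c0 h A mA.
pose nu : {measure set _ -> \bar R} :=
  measure_function_pushforward__canonical__measure_function_Measure mu mf.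
apply: (@le_measure_grid R n (mscale (NngNum c0) (lebesgue_rV R n)) nu) => //.
  move=> z; change (c%:E * lebesgue_rV R n (@grid R n 0 @^-1` [set z]) < +oo).
  by rewrite lebesgue_grid_cell -EFinM ltry.
move=> k z.
change (nu (@grid R n k @^-1` [set z]) <=
  c%:E * lebesgue_rV R n (@grid R n k @^-1` [set z])).
rewrite lebesgue_grid_cell -EFinM; exact: h.
Qed.

Lemma preimage_measure_eq n d (T : measurableType d) (mu : {measure set T -> \bar R})
    (f : T -> 'rV[R]_n) (c : R) :
  measurable_fun setT f -> (0 <= c)%R ->
  (forall k z, mu (f @^-1` (@grid R n k @^-1` [set z])) = (c * 2 ^- k ^+ n)%:E) ->
  forall A, measurable A -> mu (f @^-1` A) = c%:E * lebesgue_rV R n A.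
Proof.
move=> mf c0 h A mA.
pose nu : {measure set _ -> \bar R} :=
  measure_function_pushforward__canonical__measure_function_Measure mu mf.
apply: (@eq_measure_grid R n (mscale (NngNum c0) (lebesgue_rV R n)) nu) => //.
  move=> z; change (c%:E * lebesgue_rV R n (@grid R n 0 @^-1` [set z]) < +oo).
  by rewrite lebesgue_grid_cell -EFinM ltry.
move=> k z.
change (nu (@grid R n k @^-1` [set z]) =
  c%:E * lebesgue_rV R n (@grid R n k @^-1` [set z])).
rewrite lebesgue_grid_cell -EFinM; exact: h.
Qed.

Lemma integral_preimage_measure d d' (T : measurableType d) (T' : measurableType d')
    (mu : {measure set T -> \bar R}) (la : {measure set T' -> \bar R})
    (f : T -> T') (c : R) (h : T' -> \bar R) :
  measurable_fun setT f -> (0 <= c)%R ->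
  (forall A, measurable A -> mu (f @^-1` A) = c%:E * la A) ->
  measurable_fun setT h -> (forall y, 0 <= h y) ->
  \int[mu]_x h (f x) = c%:E * \int[la]_y h y.
Proof.
move=> mf c0 muf mh h0.
have := @ge0_integral_pushforward _ _ _ _ _ _ mf mu setT h measurableT mh (fun y _ => h0 y).
rewrite preimage_setT => <-.
rewrite (_ : c%:E = (NngNum c0)%:num%:E)// -ge0_integral_mscale//.
pose nu : {measure set _ -> \bar R} :=
  measure_function_pushforward__canonical__measure_function_Measure mu mf.
rewrite (eq_measure_integral (mscale (NngNum c0) la) (m1 := nu))//.
by move=> A mA _; rewrite /nu/= /pushforward muf.
Qed.

Lemma measurable_shift_rV n (a : 'rV[R]_n) :
  measurable_fun setT (fun v : 'rV[R]_n => v + a)%R.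
Proof.
apply: measurable_rVP => i; under eq_fun do rewrite mxE.
by apply: measurable_funD => //; exact: measurable_coord.
Qed.

Lemma lebesgue_rV_shift n (a : 'rV[R]_n) A : measurable A ->
  lebesgue_rV R n ((fun v => v + a)%R @^-1` A) = lebesgue_rV R n A.
Proof.
move=> mA; rewrite (preimage_measure_eq (c := 1)) ?mul1e//.
  exact: measurable_shift_rV.
move=> k z; rewrite mul1r -(lebesgue_rV_cube
  (fun i => (z ord0 i)%:~R / 2 ^+ k - a ord0 i)%R); last first.
  by rewrite invr_ge0 exprn_ge0.
congr (lebesgue_rV R n _); apply/seteqP; split => v /=.
  by move=> /grid_eqP h i; have := h i; rewrite mxE intrD mulrDl mul1r; lra.
by move=> h; apply/grid_eqP => i; have := h i; rewrite mxE intrD mulrDl mul1r; lra.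
Qed.

Lemma integral_shift_rV n (a : 'rV[R]_n) (h : 'rV[R]_n -> \bar R) :
  measurable_fun setT h -> (forall y, 0 <= h y) ->
  \int[lebesgue_rV R n]_x h (x + a)%R = \int[lebesgue_rV R n]_x h x.
Proof.
move=> mh h0; rewrite (integral_preimage_measure (la := lebesgue_rV R n) (c := 1)) ?mul1e//.
- exact: measurable_shift_rV.
- by move=> A mA; rewrite mul1e; exact: lebesgue_rV_shift.
Qed.

(** By uniqueness of Lebesgue measure it suffices to test half-open intervals. For [a < 0] the
    preimage has its ends swapped and is closed on the other side, which leaves its length
    unaffected. *)
Lemma lebesgue_measure_affine (a b : R) A : measurable A -> a != 0%R ->
  lebesgue_measure ((fun x => x * a + b)%R @^-1` A) = (`|a|^-1)%:E * lebesgue_measure A.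
Proof.
move=> mA a0.
have ai0 : (0 < `|a|)%R by rewrite normr_gt0.
have mf : measurable_fun setT (fun x : measurableTypeR R => x * a + b : measurableTypeR R)%R.
  by apply: measurable_funD => //; exact: measurable_funM.
pose nu : {measure set _ -> \bar R} :=
  measure_function_pushforward__canonical__measure_function_Measure (@lebesgue_measure R) mf.
have -> : lebesgue_measure A = mscale (NngNum (ltW ai0)) nu A.
  apply: lebesgue_measure_unique => // _ [[x y] _ <-].
  rewrite lebesgue_measure_itv/= /mscale/= /nu/= /pushforward.
  case: (ltgtP a 0%R) a0 => // a0 _.
    rewrite (_ : _ @^-1` _ = `[(y - b) / a, (x - b) / a[%classic)%R; last first.
      by apply/seteqP; split => t; rewrite /= !in_itv/= ler_ndivrMr// ltr_ndivlMr//
        lerBrDr ltrBlDr andbC.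
    rewrite lebesgue_measure_itv/= !lte_fin ltr_nM2r ?invr_lt0// ltrD2r.
    case: ifPn => _; last by rewrite mule0.
    rewrite -!EFinD -EFinM ltr0_norm//; congr (_%:E).
    by field; rewrite lt_eqF.
  rewrite (_ : _ @^-1` _ = `](x - b) / a, (y - b) / a]%classic)%R; last first.
    by apply/seteqP; split => t; rewrite /= !in_itv/= ler_pdivlMr// ltr_pdivrMr//
      lerBrDr ltrBlDr.
  rewrite lebesgue_measure_itv/= !lte_fin ltr_pM2r ?invr_gt0// ltrD2r.
  case: ifPn => _; last by rewrite mule0.
  rewrite -!EFinD -EFinM gtr0_norm//; congr (_%:E).
  by field; rewrite gt_eqF.
by rewrite /mscale/= muleA -EFinM mulVf ?mul1e// gt_eqF.
Qed.

Lemma measurable_mulmx_rV n m (M : 'M[R]_(n, m)) :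
  measurable_fun setT (fun v : 'rV[R]_n => v *m M)%R.
Proof.
apply: measurable_rVP => i; under eq_fun do rewrite mxE.
apply: measurable_sum => j; apply: measurable_funM => //; exact: measurable_coord.
Qed.

(** With the determinant standing beside the preimage, the property passes to products of matrices
    without any inverse. *)
Definition scales_lebesgue n (M : 'M[R]_n) := forall A, measurable A ->
  (`|\det M|)%:E * lebesgue_rV R n ((fun v => v *m M)%R @^-1` A) = lebesgue_rV R n A.

Lemma scales_lebesgueM n (M N : 'M[R]_n) :
  scales_lebesgue M -> scales_lebesgue N -> scales_lebesgue (M *m N).
Proof.
move=> hM hN A mA; rewrite det_mulmx normrM mulrC EFinM -muleA -[RHS]hN//; congr (_ * _).
rewrite -[RHS]hM; last by rewrite -[X in measurable X]setTI; exact: measurable_mulmx_rV.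
congr (_ * lebesgue_rV R n _); apply/seteqP; split => v;
  by rewrite /preimage/= mulmxA.
Qed.

Lemma scales_lebesgue_perm n (s : 'S_n) : scales_lebesgue (perm_mx s : 'M[R]_n).
Proof.
move=> A mA; rewrite det_perm normr_sign mul1e.
rewrite (preimage_measure_eq (c := 1)) ?mul1e//.
  exact: measurable_mulmx_rV.
move=> k z; rewrite mul1r -(lebesgue_rV_cube
  (fun i => (z ord0 (s i))%:~R / 2 ^+ k)%R); last by rewrite invr_ge0 exprn_ge0.
have e (v : 'rV[R]_n) i : (v *m perm_mx s)%R ord0 i = v ord0 (s^-1 i)%g.
  by rewrite -[s in LHS]invgK -col_permE mxE.
congr (lebesgue_rV R n _); apply/seteqP; split => v /=.
  move=> /grid_eqP h i; have := h (s i); rewrite e permK.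
  by rewrite intrD mulrDl mul1r.
move=> h; apply/grid_eqP => i; have := h (s^-1 i)%g; rewrite e permKV.
by rewrite intrD mulrDl mul1r.
Qed.

Lemma rV_cons_mulmx n (M : 'M[R]_n.+1) (x : R) (v : 'rV[R]_n) :
  (forall i j : 'I_n.+1, (j < i)%N -> M i j = 0%R) ->
  (rV_cons (x, v) *m M = rV_cons (x * M ord0 ord0,
     v *m \matrix_(i, j) M (lift ord0 i) (lift ord0 j)
     + x *: \row_j M ord0 (lift ord0 j)))%R.
Proof.
move=> hM; apply/rowP => j; rewrite !mxE big_ord_recl !mxE unlift_none/=.
case: (unliftP ord0 j) => [l ->|->] /=.
  rewrite !mxE addrC; congr (_ + _)%R; apply: eq_bigr => i _.
  by rewrite !mxE liftK.
rewrite big1 ?addr0// => i _.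
by rewrite hM ?mulr0.
Qed.

(** Induction on [n] by slicing. The product [(x, v) M] has first entry [x * M 0 0] and tail [v D]
    plus a multiple of a fixed row. On each slice, translation invariance removes that multiple and
    the induction hypothesis treats [D]; the outer integral rescales by [M 0 0]. *)
Lemma scales_lebesgue_upper n (M : 'M[R]_n) :
  (forall i j : 'I_n, (j < i)%N -> M i j = 0%R) -> (forall i, M i i != 0%R) ->
  scales_lebesgue M.
Proof.
move=> hM dM.
have -> : scales_lebesgue M = forall A, measurable A -> (\prod_i `|M i i|)%:E *
    lebesgue_rV R n ((fun v => v *m M)%R @^-1` A) = lebesgue_rV R n A.
  rewrite /scales_lebesgue -det_tr det_trig.
    by rewrite normr_prod; under eq_bigr do rewrite mxE.
  by apply/is_trig_mxP => i j ij; rewrite mxE hM.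
elim: n M hM dM => [|n IH] M hM dM A mA.
  rewrite big_ord0 mul1e; congr (lebesgue_rV R 0 _).
  by apply/seteqP; split => v; rewrite /preimage/= [v *m M]thinmx0 [v]thinmx0.
pose D : 'M[R]_n := (\matrix_(i, j) M (lift ord0 i) (lift ord0 j))%R.
have {}IH := IH D.
have mpre : measurable ((fun v => v *m M)%R @^-1` A).
  by rewrite -[X in measurable X]setTI; exact: measurable_mulmx_rV.
have mcons B : measurable B -> measurable (@rV_cons R n @^-1` B).
  by move=> mB; rewrite -[X in measurable X]setTI; exact: measurable_rV_cons.
rewrite big_ord_recl /= /lebesgue_rVS /pushforward /product_measure1.
pose phi (y : measurableTypeR R) := lebesgue_rV R n (xsection (@rV_cons R n @^-1` A) y).
have mphi : measurable_fun setT phi.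
  exact: measurable_fun_xsection (mcons _ mA).
have phi0 y : 0 <= phi y by exact: measure_ge0.
rewrite -/(\int[lebesgue_measure]_y phi y).
have a0 : M ord0 ord0 != 0%R by exact: dM.
transitivity ((`|M ord0 ord0|)%:E * \int[lebesgue_measure]_x phi (x * M ord0 ord0 + 0)%R).
  rewrite EFinM -muleA; congr (_ * _).
  rewrite -ge0_integralZl//; last 2 first.
  - exact: measurable_fun_xsection (mcons _ mpre).
  - by rewrite lee_fin; apply: prodr_ge0.
  apply: eq_integral => x _.
  have mx B y : measurable B -> measurable (xsection (@rV_cons R n @^-1` B) y).
    by move=> mB; apply: measurable_xsection; exact: mcons.
  rewrite addr0 /phi -(lebesgue_rV_shift (x *: \row_j M ord0 (lift ord0 j))%R); last exact: mx.
  rewrite -[RHS]IH.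
  - under [in RHS]eq_bigr do rewrite mxE.
    congr (_ * lebesgue_rV R n _); apply/seteqP; split => v;
      rewrite /xsection /preimage /= => /set_mem h; apply/mem_set; move: h;
      by rewrite /= rV_cons_mulmx.
  - by move=> i j ij; rewrite mxE hM.
  - by move=> i; rewrite mxE.
  - rewrite -[X in measurable X]setTI; apply: measurable_shift_rV => //; exact: mx.
rewrite (integral_preimage_measure (la := lebesgue_measure) (c := `|M ord0 ord0|^-1)) //.
- by rewrite muleA -EFinM mulfV ?mul1e// normr_eq0.
- by apply: measurable_funD => //; exact: measurable_funM.
- by move=> B mB; exact: lebesgue_measure_affine.
Qed.

(** Reversing the order of the coordinates conjugates a lower triangular matrix into an upper
    triangular one. *)
Lemma scales_lebesgue_lower n (M : 'M[R]_n) :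
  (forall i j : 'I_n, (i < j)%N -> M i j = 0%R) -> (forall i, M i i != 0%R) ->
  scales_lebesgue M.
Proof.
move=> hM dM; pose s : 'S_n := perm (@rev_ord_inj n).
pose M' : 'M[R]_n := (\matrix_(i, j) M (s i) (s j))%R.
have -> : M = (perm_mx s^-1 *m (M' *m perm_mx s))%R.
  have := col_permE s^-1 M'; rewrite invgK => <-; rewrite -row_permE.
  by apply/matrixP => i j; rewrite !mxE !permKV.
apply: scales_lebesgueM; first exact: scales_lebesgue_perm.
apply: scales_lebesgueM; last exact: scales_lebesgue_perm.
apply: scales_lebesgue_upper => [i j ij|i]; rewrite mxE//.
apply: hM; rewrite !permE /=; apply: ltn_sub2l => //.
by apply: leq_trans (ltn_ord i).
Qed.

(** By LUP factorization [M] is a product of a permutation matrix, a lower triangular matrix with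
    unit diagonal and an upper triangular one, whose diagonal has no zero because [\det M != 0]. *)
Lemma scales_lebesgue_unit n (M : 'M[R]_n) : \det M != 0%R -> scales_lebesgue M.
Proof.
case: n M => [|n] M dM.
  by apply: scales_lebesgue_upper; case.
have := cormen_lup_correct M; have := cormen_lup_perm M.
have := cormen_lup_detL M; have := cormen_lup_lower M; have := cormen_lup_upper M.
case: (cormen_lup M) => -[P L] U /= hU hL dL /is_perm_mxP[s ->] E.
have {}E : M = (perm_mx s^-1 *m (L *m U))%R.
  rewrite -[(L *m U)%R]E mulmxA -perm_mxM mulVg perm_mx1 mul1mx//.
have dU : \det U != 0%R.
  by apply: contra_neq dM => dU; rewrite E !det_mulmx dU !mulr0.
rewrite E; apply: scales_lebesgueM; first exact: scales_lebesgue_perm.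
apply: scales_lebesgueM.
  apply: scales_lebesgue_lower => [i j ij|i]; first by rewrite hL ?(ltnW ij)// lt_eqF.
  by rewrite hL// eqxx oner_neq0.
apply: scales_lebesgue_upper => // i.
have : \det U^T != 0%R by rewrite det_tr.
rewrite det_trig; last by apply/is_trig_mxP => k l kl; rewrite mxE hU.
by move=> /prodf_neq0/(_ i isT); rewrite mxE.
Qed.

End preimage_measure.

(** * The area inequality *)

Section continuous_det.
Context (R : realType) (T : topologicalType).

Lemma continuous_bigsum (I : Type) (r : seq I) (F : I -> T -> R) :
  (forall i, continuous (F i)) -> continuous (fun x => \sum_(i <- r) F i x).
Proof.
move=> cF; elim: r => [|i r IH].
  by under eq_fun do rewrite big_nil; move=> x; exact: cvg_cst.
by under eq_fun do rewrite big_cons; move=> x; apply: cvgD; [exact: cF|exact: IH].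
Qed.

Lemma continuous_bigprod (I : Type) (r : seq I) (F : I -> T -> R) :
  (forall i, continuous (F i)) -> continuous (fun x => \prod_(i <- r) F i x).
Proof.
move=> cF; elim: r => [|i r IH].
  by under eq_fun do rewrite big_nil; move=> x; exact: cvg_cst.
by under eq_fun do rewrite big_cons; move=> x; apply: cvgM; [exact: cF|exact: IH].
Qed.

Lemma continuous_det n (A : T -> 'M[R]_n) :
  (forall i j, continuous (fun x => A x i j)) -> continuous (fun x => \det (A x)).
Proof.
move=> cA; apply: continuous_bigsum => s x; apply: cvgM; first exact: cvg_cst.
by apply: continuous_bigprod => i; exact: cA.
Qed.

Lemma continuous_mulmx_sub n (A : T -> 'M[R]_n) (B C : 'M[R]_n) :
  (forall i j, continuous (fun x => A x i j)) ->
  forall i j, continuous (fun x => (A x *m B - C) i j).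
Proof.
move=> cA i j; under eq_fun do rewrite !mxE.
move=> x; apply: cvgB; last exact: cvg_cst.
apply: continuous_bigsum => k {}x; apply: cvgM; last exact: cvg_cst.
exact: cA.
Qed.

End continuous_det.

Section integral_mrestr.
Local Open Scope ereal_scope.
Context d (T : measurableType d) (R : realType) (mu : {measure set T -> \bar R}).

Lemma ge0_integral_mrestr (D : set T) (mD : measurable D) (h : T -> \bar R) :
  measurable_fun setT h -> (forall x, 0 <= h x) ->
  \int[mrestr mu mD]_x h x = \int[mu]_(x in D) h x.
Proof.
move=> mh h0; rewrite -(setUv D) ge0_integral_setU//; last 3 first.
- exact: measurableC.
- exact: measurable_funTS.
- exact/disj_setPCl.
rewrite [X in _ + X](_ : _ = 0) ?adde0; last first.
  apply: null_set_integral => //; first exact: measurableC.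
    exact: measurable_funTS.
  by change (mu (~` D `&` D) = 0); rewrite setICl measure0.
apply: eq_measure_integral => A mA AD.
by change (mu (A `&` D) = mu A); rewrite setIidl.
Qed.

End integral_mrestr.

Section small_diameter.
Context (R : realType) (n : nat).

Lemma lebesgue_rV_diameter (S : set 'rV[R]_n) (d : R) :
  measurable S -> 0 <= d ->
  (forall x y, S x -> S y -> forall i, x ord0 i - y ord0 i <= d) ->
  (lebesgue_rV R n S <= (d ^+ n)%:E)%E.
Proof.
move=> mS d0 hS; have [->|/set0P[x0 Sx0]] := eqVneq S set0.
  by rewrite measure0 lee_fin exprn_ge0.
pose w i := inf [set x ord0 i | x in S].
have wlb i x : S x -> w i <= x ord0 i.
  move=> Sx; apply: ge_inf; last by exists x.
  by exists (x0 ord0 i - d) => _ [y Sy <-]; rewrite lerBlDr -lerBlDl; exact: hS.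
have wub i x : S x -> x ord0 i <= w i + d.
  move=> Sx; rewrite -lerBlDr; apply: lb_le_inf; first by exists (x ord0 i), x.
  by move=> _ [y Sy <-]; rewrite lerBlDr -lerBlDl; exact: hS.
have -> : (d ^+ n)%:E = lebesgue_rV R n [set v | forall i,
    `[w i, w i + d]%classic (v ord0 i)].
  rewrite lebesgue_rV_itv; last by move=> i; rewrite lerDl.
  congr (_%:E); rewrite (eq_bigr (fun=> d)) ?prodr_const ?card_ord// => i _.
  by rewrite [X in X - _]addrC addrK.
apply: le_measure.
- exact/mem_set.
- by apply/mem_set; apply: (measurable_rV_box (A := fun i => `[w i, w i + d]%classic)).
by move=> x Sx i; rewrite /= in_itv/= wlb ?wub.
Qed.

Lemma le_coord_norm (v : 'rV[R]_n) i : `|v ord0 i| <= `|v|.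
Proof.
rewrite [leRHS]/Num.Def.normr/= mx_normrE.
exact: (le_bigmax _ (fun ij => `|v ij.1 ij.2|) (ord0, i)).
Qed.

Lemma norm_le_coord (v : 'rV[R]_n) (d : R) : 0 <= d ->
  (forall i, `|v ord0 i| <= d) -> `|v| <= d.
Proof.
move=> d0 h; rewrite [leLHS]/Num.Def.normr/= mx_normrE.
by apply/bigmax_leP; split => // -[i j] _ /=; rewrite ord1.
Qed.

Lemma continuous_coord_comp (T : topologicalType) m (f : T -> 'rV[R]_m) i :
  continuous f -> continuous (fun x => f x ord0 i).
Proof.
move=> cf x; apply: (@cvg_comp _ _ _ f (fun v => v ord0 i) _ (nbhs (f x)) _ (cf x)).
exact: coord_continuous.
Qed.

Lemma continuous_rV_measurable m (f : 'rV[R]_n -> 'rV[R]_m) :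
  continuous f -> measurable_fun setT f.
Proof.
move=> cf; apply: measurable_rVP => i; apply: continuous_measurable_rV.
exact: continuous_coord_comp.
Qed.

(* An expanding map pulls a cell back to a set of comparable diameter, and
   for the sup norm a set of diameter d lies in a cube of side d. *)
Lemma expanding_preimage_le (Q : set 'rV[R]_n) (phi : 'rV[R]_n -> 'rV[R]_n)
    (M : R) (E : set 'rV[R]_n) :
  measurable Q -> measurable_fun setT phi -> 0 <= M ->
  (forall x y, Q x -> Q y -> `|x - y| <= M * `|phi x - phi y|) ->
  measurable E ->
  (lebesgue_rV R n (phi @^-1` E `&` Q) <= (M ^+ n)%:E * lebesgue_rV R n E)%E.
Proof.
move=> mQ mphi M0 hphi mE.
apply: (preimage_measure_le (mu := mrestr (lebesgue_rV R n) mQ) (c := M ^+ n)) => //.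
  exact: exprn_ge0.
move=> k z; rewrite -exprMn; apply: lebesgue_rV_diameter.
- apply: measurableI => //; rewrite -[X in measurable X]setTI; apply: mphi => //.
  exact: measurable_grid.
- by rewrite mulr_ge0// invr_ge0 exprn_ge0.
move=> x y [/grid_eqP zx Qx] [/grid_eqP zy Qy] i.
have := le_coord_norm (x - y) i; rewrite !mxE => /(le_trans (ler_norm _)).
move=> /le_trans; apply; apply: (le_trans (hphi x y Qx Qy)).
apply: ler_wpM2l => //; apply: norm_le_coord; first by rewrite invr_ge0 exprn_ge0.
move=> j; rewrite !mxE; have := zx j; have := zy j; rewrite !intrD !mulrDl !mul1r.
by move=> /andP[h1 h2] /andP[h3 h4]; rewrite ler_norml; apply/andP; split; lra.
Qed.

End small_diameter.

Lemma dist_lt_norm (R : realDomainType) (a b : R) :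
  `|a - b| < `|a| -> b != 0 /\ `|b| <= 2 * `|a|.
Proof.
move=> h; split; first by apply: contraTneq h => ->; rewrite subr0 ltxx.
by have := ler_normB a (a - b); rewrite subKr; lra.
Qed.

Section area_inequality.
Context (R : realType) (n : nat) (psi : 'rV[R]_n -> 'rV[R]_n).
Hypothesis dpsi : forall x, differentiable psi x.
Hypothesis cpsi : forall v, continuous (fun x => 'd psi x v).

Let psi_continuous : continuous psi.
Proof. by move=> x; exact: differentiable_continuous. Qed.

Let mpsi : measurable_fun setT psi.
Proof. exact: continuous_rV_measurable. Qed.

Let continuous_jacobian i j : continuous (fun x => 'J psi x i j).
Proof.
under eq_fun do rewrite /jacobian /lin1_mx mxE.
exact: (continuous_coord_comp (f := fun x => 'd psi x (delta_mx 0 i))).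
Qed.

Lemma measurable_det_jacobian :
  measurable_fun setT (fun x => (`|\det ('J psi x)|)%:E).
Proof.
apply/measurable_EFinP; apply: measurableT_comp => //.
by apply: continuous_measurable_rV; exact: continuous_det.
Qed.

(** The mean value theorem is scalar, so [tau] depends on the coordinate [i]. This is enough for the
    sup norm once the Jacobian is controlled on the whole segment. *)
Lemma mean_value_coord (B : 'M[R]_n) (x y : 'rV[R]_n) i :
  exists2 tau : R, 0 <= tau <= 1 &
   ((psi x - psi y) *m B - (x - y)) ord0 i =
   ((x - y) *m ('J psi (y + tau *: (x - y)) *m B - 1%:M)) ord0 i.
Proof.
set u := x - y; pose line (t : R) : 'rV[R]_n := y + t *: u.
pose G (k : 'I_n) (t : R) : R := psi (line t) ord0 k.
have dG k (t : R) : is_derive t (1 : R) (G k) ((u *m 'J psi (line t)) ord0 k).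
  have dmx : derivable (fun t => psi (line t)) t 1 /\
      'D_1 (fun t => psi (line t)) t = u *m 'J psi (line t).
    have e : (fun h : R => h^-1 *: (psi (line (h *: 1 + t)) - psi (line t))) =
             (fun h : R => h^-1 *: (psi (h *: u + line t) - psi (line t))).
      apply/funext => h; congr (_ *: (psi _ - _)).
      by rewrite /line scalerDl /GRing.scale/= mulr1 addrCA.
    split.
      by rewrite /derivable e; exact: diff_derivable.
    by rewrite -(deriveEjacobian u (dpsi _)) /derive e.
  have [dm De] := dmx; split; first by have /derivable_mxP := dm; apply.
  by rewrite -De derive_mx// mxE.
pose f : R -> R := \sum_(k < n) (B k i \*: G k) - u ord0 i \*: (id : R -> R).
pose df (t : R) : R := \sum_(k < n) (B k i *: (u *m 'J psi (line t)) ord0 k) - u ord0 i *: 1.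
have dfP (t : R) : is_derive t (1 : R) f (df t) by apply: is_deriveB.
have cf : {within `[0, 1], continuous f}.
  apply: continuous_subspaceT => t; apply: differentiable_continuous.
  by apply/derivable1_diffP; have [] := dfP t.
have [c] := @MVT_segment R f df 0 1 ler01 (fun t _ => dfP t) cf.
rewrite in_itv/= => c01 E; exists c => //.
have fE t : f t = (psi (line t) *m B) ord0 i - t * u ord0 i.
  rewrite /f !fctE fct_sumE; congr (_ - _); last by rewrite /GRing.scale/= mulrC.
  by rewrite [RHS]mxE; apply: eq_bigr => k _; rewrite /G /GRing.scale/= mulrC.
have dfE t : df t = (u *m 'J psi (line t) *m B) ord0 i - u ord0 i.
  rewrite /df; congr (_ - _); last by rewrite /GRing.scale/= mulr1.
  by rewrite [RHS]mxE; apply: eq_bigr => k _; rewrite /GRing.scale/= mulrC.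
have subE (a b : 'rV[R]_n) : (a - b) ord0 i = a ord0 i - b ord0 i by rewrite !mxE.
move: E; rewrite !fE dfE subr0 mulr1 mul0r mul1r subr0 /line scale1r scale0r addr0.
rewrite [y + u]addrC subrK => E.
rewrite mulmxBr mulmx1 mulmxA (subE _ u) (subE (_ *m _ *m _) u) -E mulmxBl.
by rewrite (subE (psi x *m B)); ring.
Qed.

(** [L] stands for the Jacobian at a nearby point. The two bounds serve together: the first limits
    how much [S] can be larger than its image, the second compares the weight with [\det L]. *)
Definition expands_on (S : set 'rV[R]_n) := exists L : 'M[R]_n,
  [/\ \det L != 0,
      forall x y, S x -> S y ->
        `|x - y| <= 2 * `|psi x *m invmx L - psi y *m invmx L| &
      forall x, S x ->
        \det ('J psi x) != 0 /\ `|\det ('J psi x)| <= 2 * `|\det L| ].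

Lemma expands_on_sub S S' : S `<=` S' -> expands_on S' -> expands_on S.
Proof.
move=> SS' [L [dL h1 h2]]; exists L; split=> // [x y /SS' Sx /SS' Sy|x /SS' Sx].
  exact: h1.
exact: h2.
Qed.

(** As in the inverse function theorem, [psi] followed by [invmx L] differs from the identity by a
    map that contracts by a factor 1/2, because [A] vanishes at [x0] and is continuous. *)
Lemma expands_on_ball (x0 : 'rV[R]_n) : \det ('J psi x0) != 0 ->
  exists2 r : R, 0 < r & expands_on (ball x0 r).
Proof.
move=> d0; set L := 'J psi x0; pose B := invmx L.
pose A x := 'J psi x *m B - 1%:M.
have cA i j : continuous (fun x => A x i j). by apply: continuous_mulmx_sub.
have A0 : A x0 = 0 by rewrite /A /B mulmxV ?subrr// unitmxE unitfE.
have cdet : continuous (fun x => \det ('J psi x)) by exact: continuous_det.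
(* A coordinate of a row times [A] is a sum of [n] terms, so this bound on the entries gives the
   factor 1/2; [n.+1] keeps [e] meaningful for [n = 0]. *)
pose e : R := (2 * n.+1%:R)^-1.
have e0 : 0 < e by rewrite invr_gt0 mulr_gt0.
have nA : \forall x \near x0, forall i j, `|A x i j| <= e.
  have H i j : \forall x \near x0, `|A x i j| <= e.
    have := cA i j x0; move/cvgrPdist_le => /(_ _ e0); rewrite A0 mxE.
    by apply: filterS => x; rewrite sub0r normrN.
  exact: (@filter_forall _ _ _ (nbhs x0) _
    (fun i => @filter_forall _ _ _ (nbhs x0) _ (H i))).
have aL0 : 0 < `|\det L| by rewrite normr_gt0.
have nd : \forall x \near x0, `|\det L - \det ('J psi x)| < `|\det L|.
  by have := cdet x0; move/cvgrPdist_lt => /(_ _ aL0).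
have [r /= r0 hr] : exists2 r : R, 0 < r & ball x0 r `<=`
    [set x | (forall i j, `|A x i j| <= e) /\
             `|\det L - \det ('J psi x)| < `|\det L| ].
  by apply/nbhs_ballP; exact: filterI.
exists r; first exact: r0.
exists L; split; [exact: d0| |]; last first.
  by move=> x /hr[_]; exact: dist_lt_norm.
move=> x y Bx By; rewrite -mulmxBl.
have half : `|(psi x - psi y) *m B - (x - y)| <= `|x - y| / 2.
  apply: norm_le_coord; first by rewrite divr_ge0.
  move=> i; have [tau /andP[t0 t1] ->] := mean_value_coord B x y i.
  set xi := y + _.
  have /hr[hA _] : ball x0 r xi.
    move: Bx By; rewrite -ball_normE/= => Bx By.
    rewrite (_ : x0 - xi = (1 - tau) *: (x0 - y) + tau *: (x0 - x)); last first.
      by apply/rowP => k; rewrite !mxE; ring.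
    rewrite (le_lt_trans (ler_normD _ _))// !normrZ !ger0_norm ?subr_ge0//.
    have [->|tn0] := eqVneq tau 0; first by rewrite subr0 mul1r mul0r addr0.
    have tp : 0 < tau by rewrite lt_neqAle eq_sym tn0.
    nra.
  rewrite mxE (le_trans (ler_norm_sum _ _ _))//.
  apply: (@le_trans _ _ (\sum_(j < n) `|x - y| * e)).
    by apply: ler_sum => j _; rewrite normrM ler_pM// ?le_coord_norm//; exact: hA.
  rewrite sumr_const card_ord -mulrnAr ler_wpM2l// /e invfM -mulrnAr ler_piMr//.
  by rewrite -mulr_natr ler_pdivrMl// mulr1 ler_nat.
have := ler_normB ((psi x - psi y) *m B) ((psi x - psi y) *m B - (x - y)).
by rewrite subKr; lra.
Qed.

Local Open Scope ereal_scope.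

(** The weight is at most [2 |\det L|]. Pulling a set back by [psi] costs [2^n] for the expanding
    map and [1 / |\det L|] for the linear map [L]; the determinants cancel and [2^(n+1)] remains. *)
Lemma area_piece (S : set 'rV[R]_n) (g : 'rV[R]_n -> \bar R) :
  measurable S -> measurable (psi @` S) -> expands_on S ->
  measurable_fun setT g -> (forall y, 0 <= g y) ->
  \int[lebesgue_rV R n]_(x in S) (g (psi x) * (`|\det ('J psi x)|)%:E) <=
    (2 ^+ n.+1)%:E * \int[lebesgue_rV R n]_(y in psi @` S) g y.
Proof.
move=> mS mpS [L [dL hexp hdet]] mg g0.
have aL0 : (0 < `|\det L|)%R by rewrite normr_gt0.
have mdet := measurable_det_jacobian.
have mgpsi : measurable_fun setT (g \o psi) by exact: measurableT_comp.
apply: (@le_trans _ _ (\int[lebesgue_rV R n]_(x in S)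
    ((2 * `|\det L|)%:E * g (psi x)))).
  apply: ge0_le_integral => //.
  - by move=> x _; rewrite mule_ge0.
  - by apply: measurable_funTS; exact: emeasurable_funM.
  - by apply: measurable_funTS; exact: emeasurable_funM.
  - by move=> x Sx; rewrite muleC lee_wpmul2r// lee_fin; have [] := hdet x Sx.
rewrite ge0_integralZl//; last exact: measurable_funTS.
pose K := (2 ^+ n / `|\det L|)%R.
have K0 : (0 <= K)%R by rewrite divr_ge0// exprn_ge0.
suff H : \int[lebesgue_rV R n]_(x in S) g (psi x) <=
    K%:E * \int[lebesgue_rV R n]_(y in psi @` S) g y.
  apply: (le_trans (lee_wpmul2l _ H)); first by rewrite lee_fin mulr_ge0.
  rewrite muleA -EFinM /K exprS.
  by rewrite (_ : (_ * _ = 2 * 2 ^+ n)%R)//; field; rewrite gt_eqF.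
rewrite -(ge0_integral_mrestr _ mS)// -(ge0_integral_mrestr _ mpS)//.
have := @ge0_integral_pushforward _ _ _ _ _ _ mpsi
  (mrestr (lebesgue_rV R n) mS) setT g measurableT mg (fun y _ => g0 y).
rewrite preimage_setT => <-.
rewrite (_ : K%:E = (NngNum K0)%:num%:E)// -ge0_integral_mscale//.
pose nu : {measure set _ -> \bar R} :=
  measure_function_pushforward__canonical__measure_function_Measure
    (mrestr (lebesgue_rV R n) mS) mpsi.
apply: (ge0_le_measure_integral (m1 := nu)) => // E mE.
rewrite /nu/= /pushforward /mscale/= /mrestr.
have mE' : measurable (E `&` psi @` S) by exact: measurableI.
have mE'' : measurable ((fun v => v *m L)%R @^-1` (E `&` psi @` S)).
  by rewrite -[X in measurable X]setTI; exact: measurable_mulmx_rV.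
rewrite -(scales_lebesgue_unit dL mE') muleA -EFinM /K divfK ?gt_eqF//.
apply: le_trans (expanding_preimage_le (phi := fun x => (psi x *m invmx L)%R)
  mS _ _ hexp mE'') => //.
  apply: le_measure.
  - apply/mem_set; apply: measurableI => //.
    by rewrite -[X in measurable X]setTI; exact: mpsi.
  - apply/mem_set; apply: measurableI => //.
    rewrite -[X in measurable X]setTI.
    by apply: (measurableT_comp (measurable_mulmx_rV _) mpsi).
  move=> x [Ex Sx]; split => //; rewrite /preimage/= mulmxKV ?unitmxE ?unitfE//.
  by split => //; exists x.
exact: (measurableT_comp (measurable_mulmx_rV _) mpsi).
Qed.

End area_inequality.

Section sigma_compact_image.
Context (R : realType) (n : nat).

(** Continuous images of Borel sets need not be Borel, but a half-open cell is a countable union of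
    compact boxes, and their images are compact. *)
Lemma measurable_image_cell (psi : 'rV[R]_n -> 'rV[R]_n) k z : continuous psi ->
  measurable (psi @` (@grid R n k @^-1` [set z])).
Proof.
move=> cpsi.
pose K (m : nat) := [set v : 'rV[R]_n | forall i,
  `[(z ord0 i)%:~R / 2 ^+ k, (z ord0 i + 1)%:~R / 2 ^+ k - m.+1%:R^-1]%classic (v ord0 i)].
rewrite (_ : _ @^-1` _ = \bigcup_m K m); last first.
  apply/seteqP; split => v.
    move=> /grid_eqP vz.
    have [m _ /(_ m (leqnn m)) hm] : \forall m \near \oo, forall i : 'I_n,
        m.+1%:R^-1 < (z ord0 i + 1)%:~R / 2 ^+ k - v ord0 i.
      apply: (@filter_forall _ _ _ (nbhs \oo)) => i.
      have d0 : 0 < (z ord0 i + 1)%:~R / 2 ^+ k - v ord0 i.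
        by rewrite subr_gt0; have /andP[] := vz i.
      exact: (near_infty_natSinv_lt (PosNum d0)).
    exists m => // i; rewrite /= in_itv/=; have := vz i; have := hm i.
    by move=> h /andP[-> _]/=; rewrite lerBrDr -lerBrDl ltW.
  move=> [m _ Kv]; apply/grid_eqP => i; have := Kv i; rewrite /= in_itv/=.
  move=> /andP[-> h]/=; apply: le_lt_trans h _.
  by rewrite ltrBlDr ltrDl invr_gt0.
rewrite image_bigcup; apply: bigcup_measurable => m _.
apply: closed_measurable_rV; apply: compact_closed; first exact: norm_hausdorff.
apply: continuous_compact; first exact: continuous_subspaceT.
exact: (@rV_compact R n (fun i => `[(z ord0 i)%:~R / 2 ^+ k,
  (z ord0 i + 1)%:~R / 2 ^+ k - m.+1%:R^-1]%classic)
  (fun i => @segment_compact R _ _)).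
Qed.

End sigma_compact_image.

(** * Summation over cells with bounded multiplicity *)

Section area_multiplicity.
Local Open Scope ereal_scope.
Context (R : realType) (n : nat) (psi : 'rV[R]_n -> 'rV[R]_n).
Hypothesis dpsi : forall x, differentiable psi x.
Hypothesis cpsi : forall v, continuous (fun x => 'd psi x v).

Let psi_continuous : continuous psi.
Proof. by move=> x; exact: differentiable_continuous. Qed.

Lemma sum_const_if (s : seq nat) (P : pred nat) (c : \bar R) : 0 <= c ->
  \sum_(j <- s) (if P j then c else 0) = (count P s)%:R%:E * c.
Proof.
move=> c0; elim: s => [|j s IH]; first by rewrite big_nil mul0e.
rewrite big_cons IH /= natrD EFinD ge0_muleDl// ?lee_fin//.
by case: (P j); rewrite ?mul1e ?mul0e.
Qed.

(** Each piece whose image contains [y] holds a point of the fibre, and disjoint pieces hold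
    different ones; an injection of the fibre into [I_N] then labels these pieces. *)
Lemma count_fiber_le (T U : Type) (f : T -> U) (y : U) (A : set T) (N : nat)
    (D : nat -> set T) (s : seq nat) :
  ([set x | f x = y /\ A x] #<= `I_N)%card -> trivIset setT D ->
  (forall j, D j `<=` A) -> uniq s ->
  (count (fun j => `[< (f @` D j) y >]) s <= N)%N.
Proof.
move=> /pcard_leP[h] tD DA us; rewrite -size_filter.
have /choice[x hx] : forall j, exists l : nat, (f @` D j) y ->
    exists t, [/\ D j t, f t = y & h t = l].
  move=> j; have [[t Dt ft]|nD] := pselect ((f @` D j) y); last by exists 0%N.
  by exists (h t) => _; exists t.
rewrite -(size_map x) -[N in (_ <= N)%N](size_iota 0); apply: uniq_leq_size.
  rewrite map_inj_in_uniq ?filter_uniq// => i j.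
  rewrite !mem_filter => /andP[/asboolP/hx[t [Dt ft ht]] _].
  move=> /andP[/asboolP/hx[t' [Dt' ft' ht']] _] xij.
  apply: (tD i j) => //; exists t; split => //.
  suff -> : t = t' by [].
  have ih : {in [set x | f x = y /\ A x] &, injective h} by exact: 'inj_h.
  apply: ih; last by rewrite ht ht'.
  - by apply/mem_set; split => //; exact: DA Dt.
  - by apply/mem_set; split => //; exact: DA Dt'.
move=> _ /mapP[j + ->]; rewrite mem_filter => /andP[/asboolP/hx[t [Dt ft <-]] _].
rewrite mem_iota add0n; have : `I_N (h t) by apply: funS; split => //; exact: DA Dt.
by [].
Qed.

(** Whole cells are tested, so that [good k] is a union of cells and is measurable. It grows with
    [k] and exhausts the set where the Jacobian is invertible. *)
Let good k : set 'rV[R]_n := [set x | expands_on psi (@grid R n k @^-1` [set grid k x])].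

Let measurable_good k : measurable (good k).
Proof.
exact: (measurable_grid k [set z | expands_on psi (@grid R n k @^-1` [set z])]).
Qed.

Let good_cell k j : good k `&` @gridn R n k @^-1` [set j] = set0 \/
  exists2 z, good k `&` @gridn R n k @^-1` [set j] = @grid R n k @^-1` [set z] &
    expands_on psi (@grid R n k @^-1` [set z]).
Proof.
have [->|[z ->]] := gridn_cell R n k j; first by left; rewrite setI0.
have [ez|nez] := pselect (expands_on psi (@grid R n k @^-1` [set z])); [right|left].
  exists z => //; apply/seteqP; split => [v []//|v vz]; split => //.
  by rewrite /good/= vz.
apply/seteqP; split => // v [+ vz]; rewrite /good/= => h; apply: nez.
by rewrite -vz.
Qed.

Lemma area_inequality (N : nat) (g : 'rV[R]_n -> \bar R) :
  (forall y, ([set x | psi x = y /\ `|\det ('J psi x)|%R != 0%R] #<= `I_N)%card) ->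
  measurable_fun setT g -> (forall y, 0 <= g y) ->
  \int[lebesgue_rV R n]_x (g (psi x) * (`|\det ('J psi x)|)%:E) <=
    (2 ^+ n.+1 * N%:R)%:E * \int[lebesgue_rV R n]_y g y.
Proof.
move=> fib mg g0.
pose h x := g (psi x) * (`|\det ('J psi x)|)%:E.
have h0 x : 0 <= h x by rewrite /h mule_ge0.
have mh : measurable_fun setT h.
  apply: emeasurable_funM.
    by apply: measurableT_comp mg _; exact: continuous_rV_measurable.
  exact: measurable_det_jacobian.
rewrite -/(\int[lebesgue_rV R n]_x h x).
(* Outside the good sets the determinant is zero, and so is [h]. Restricting to them allows the
   fibre bound to count nondegenerate points only. *)
have -> : \int[lebesgue_rV R n]_x h x = \int[lebesgue_rV R n]_(x in \bigcup_k good k) h x.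
  rewrite [RHS]integral_mkcond; apply: eq_integral => x _.
  rewrite patchE; case: ifPn => // /negP xG; apply/eqP; apply/negP => /negP hx.
  apply: xG; apply/mem_set.
  have dx : \det ('J psi x) != 0%R.
    by apply: contra_neq hx => dx; rewrite /h dx normr0 mule0.
  have [r r0 er] := expands_on_ball dpsi cpsi dx.
  have [k _ /(_ k (leqnn k))/= kr] := near_infty_natSinv_expn_lt (PosNum r0).
  exists k => //; apply: expands_on_sub er => w /esym wx.
  rewrite -ball_normE/=; apply: le_lt_trans kr; rewrite mul1r.
  apply: norm_le_coord; first by rewrite invr_ge0 exprn_ge0.
  move=> i; rewrite !mxE.
  have /grid_eqP/(_ i) := erefl (grid k x); have /grid_eqP/(_ i) := esym wx.
  rewrite intrD !mulrDl !mul1r.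
  by move=> /andP[h1 h2] /andP[h3 h4]; rewrite ler_norml; apply/andP; split; lra.
have ndg : nondecreasing_seq good.
  move=> k l kl; apply/subsetPset => x; rewrite /good/=; apply: expands_on_sub.
  by move=> w /= /(grid_coarsen kl).
have := @ge0_nondecreasing_set_cvg_integral _ _ _ good h (lebesgue_rV R n) ndg
  measurable_good (fun i => measurable_funTS mh) (fun i x _ => h0 x).
move=> /cvg_lim <-//; apply: lime_le.
  apply: ereal_nondecreasing_is_cvgn.
  apply: ge0_nondecreasing_set_nondecreasing_integral => // i.
  exact: measurable_funTS.
(* Monotone convergence has reduced the estimate to a single level [k], with a constant independent
   of [k]. *)
apply: nearW => k; pose C j := good k `&` @gridn R n k @^-1` [set j].
have mC j : measurable (C j) by apply: measurableI => //; exact: measurable_gridn.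
have mpC j : measurable (psi @` C j).
  rewrite /C; have [->|[z -> _]] := good_cell k j; first by rewrite image_set0.
  exact: measurable_image_cell.
have tC : trivIset setT C by move=> i j _ _ [x [[_ /= <-] [_ /= <-]]].
have CE : good k = \bigcup_j C j.
  by apply/seteqP; split => [x gx|x [j _ []]//]; exists (gridn k x).
have CA j x : C j x -> `|\det ('J psi x)|%R != 0%R.
  rewrite /C; have [->//|[z -> [L [_ _ hL]]] Cx] := good_cell k j.
  by rewrite normr_eq0; have [] := hL x Cx.
rewrite CE ge0_integral_bigcup//; last exact: measurable_funTS.
apply: (@le_trans _ _ (\sum_(j <oo)
  ((2 ^+ n.+1)%:E * \int[lebesgue_rV R n]_(y in psi @` C j) g y))).
  apply: lee_nneseries => [j _ _|j _]; first by apply: integral_ge0.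
  apply: area_piece => //; rewrite /C.
  have [->|[z -> //]] := good_cell k j.
  (* This is the empty piece: any invertible matrix is a witness. *)
  exists 1%:M%R; split => //; first by rewrite det1 oner_neq0.
rewrite nneseriesZl; last by move=> j _; exact: integral_ge0.
rewrite EFinM -muleA; apply: lee_wpmul2l; first by rewrite lee_fin exprn_ge0.
under eq_eseriesr do rewrite integral_mkcond.
rewrite -integral_nneseries//; last 2 first.
- by move=> j; apply/(measurable_restrictT g); [exact: mpC|exact: measurable_funTS].
- by move=> j y _; apply: erestrict_ge0.
rewrite -ge0_integralZl//.
apply: ge0_le_integral => //.
- by move=> y _; apply: nneseries_ge0 => j _ _; apply: erestrict_ge0.
- apply: ge0_emeasurable_sum => // [j y _ _|j _]; first exact: erestrict_ge0.
  by apply/(measurable_restrictT g); [exact: mpC|exact: measurable_funTS].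
- exact: measurable_funeM.
move=> y _; apply: lime_le.
  by apply: is_cvg_nneseries => j _ _; apply: erestrict_ge0.
apply: nearW => m.
(* The sum is [g y] times the number of pieces whose image contains [y], a number that the fibre
   bound limits to [N]. *)
have -> : \sum_(0 <= j < m) (g \_ (psi @` C j)) y =
    \sum_(0 <= j < m) (if `[< (psi @` C j) y >] then g y else 0).
  by apply: eq_bigr => j _; rewrite patchE.
rewrite sum_const_if//; apply: lee_wpmul2r => //; rewrite lee_fin ler_nat.
apply: (count_fiber_le (A := fun x => `|\det ('J psi x)|%R != 0%R) (fib y)) => //.
exact: iota_uniq.
Qed.

End area_multiplicity.

(** * Integral inequalities *)

Lemma ge0_lee_poweR (R : realType) (x y : \bar R) (r : R) :
  0 <= r -> (0 <= x)%E -> (x <= y)%E -> (x `^ r <= y `^ r)%E.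
Proof.
move=> r0 x0 xy; apply: gt0_ler_poweR => //; rewrite in_itv/= leey andbT//.
exact: le_trans xy.
Qed.

Section hoelder_ge0.
Local Open Scope ereal_scope.
Context d (T : measurableType d) (R : realType) (mu : {measure set T -> \bar R}).

Lemma measurable_fun_powR (H : T -> R) c : measurable_fun setT H ->
  measurable_fun setT (fun x => H x `^ c)%R.
Proof. by move=> mH; exact: (@measurableT_comp _ _ _ _ _ _ (@powR R ^~ c)). Qed.

(** This is Hölder with exponents [1/a] and [1/b] for [F^a] and [G^b], whose norms are powers of the
    integrals of [F] and [G] themselves. *)
Lemma hoelder_ge0 (F G : T -> R) (a b : R) :
  measurable_fun setT F -> measurable_fun setT G ->
  (forall x, 0 <= F x)%R -> (forall x, 0 <= G x)%R ->
  (0 < a)%R -> (0 < b)%R -> (a + b = 1)%R ->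
  \int[mu]_x (F x `^ a * G x `^ b)%:E <=
  (\int[mu]_x (F x)%:E) `^ a * (\int[mu]_x (G x)%:E) `^ b.
Proof.
move=> mF mG F0 G0 a0 b0 ab.
have := @hoelder _ _ _ mu (fun x => F x `^ a)%R (fun x => G x `^ b)%R a^-1 b^-1
  (measurable_fun_powR _ mF) (measurable_fun_powR _ mG).
rewrite !invr_gt0 !invrK => /(_ a0 b0 ab); rewrite Lnorm1 unlock /= !invrK.
have E (H : T -> R) c : (forall x, 0 <= H x)%R -> (0 < c)%R ->
    \int[mu]_x `| (H x `^ c)%:E | `^ c^-1 = \int[mu]_x (H x)%:E.
  move=> H0 c0; apply: eq_integral => x _.
  by rewrite gee0_abs ?lee_fin ?powR_ge0// poweR_EFin -powRrM mulfV ?gt_eqF// powRr1.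
rewrite [X in _ <= X `^ _ * _](E F a F0 a0) [X in _ <= _ * X `^ _](E G b G0 b0).
apply: le_trans.
rewrite le_eqVlt; apply/orP; left; apply/eqP; apply: eq_integral => x _.
by rewrite ger0_norm// mulr_ge0 ?powR_ge0.
Qed.

(* Two applications of Hölder: first [‖f‖_1^(m+1) <= ‖f^p‖_1 ‖f^(p/m)‖_1^m] with
   [p = (m+1)/2], then the reverse Hölder inequality against the weight w. *)
Lemma integral_le_double_integral (f : T -> R) (w : T -> T -> R)
    (D : set T) (m K : R) :
  measurable_fun setT f -> (forall x, 0 <= f x)%R ->
  measurable_fun setT (fun z : T * T => w z.1 z.2) ->
  (forall s t, 0 <= w s t)%R ->
  {ae mu, forall s, D s} ->
  (forall s, D s -> {ae mu, forall t, w s t != 0%R}) ->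
  (1 < m)%R -> (0 <= K)%R ->
  (forall s, D s -> \int[mu]_t (w s t `^ (- (m - 1)^-1))%:E <= K%:E) ->
  measurable_fun setT (fun s => \int[mu]_t (f t `^ ((m + 1) / 2) * w s t)%:E) ->
  (\int[mu]_t (f t)%:E) `^ (m + 1) <= (K `^ (m - 1))%:E *
   \int[mu]_s ((f s `^ ((m + 1) / 2))%:E *
     \int[mu]_t (f t `^ ((m + 1) / 2) * w s t)%:E).
Proof.
move=> mf f0 mw w0 Dae wae m1 K0 hK mI; set p := ((m + 1) / 2)%R.
have m0 : (0 < m)%R by rewrite (lt_trans _ m1).
have mp0 : (0 < m + 1)%R by rewrite addr_gt0.
have mm0 : (0 < m - 1)%R by rewrite subr_gt0.
have mpow c : measurable_fun setT (fun x => f x `^ c)%R.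
  by apply: measurable_fun_powR.
have mws s : measurable_fun setT (w s).
  exact: (measurableT_comp mw (measurable_pair1 s)).
have p0 : (0 < p)%R by rewrite divr_gt0.
set X := \int[mu]_t (f t `^ p)%:E; set Y := \int[mu]_t (f t `^ (p / m))%:E.
have X0 : 0 <= X by apply: integral_ge0 => x _; rewrite lee_fin powR_ge0.
have Y0 : 0 <= Y by apply: integral_ge0 => x _; rewrite lee_fin powR_ge0.
(* Here [f = (f^p)^(1/(m+1)) (f^(p/m))^(m/(m+1))], because [2 p = m + 1]. *)
have step1 : (\int[mu]_t (f t)%:E) `^ (m + 1) <= X * Y `^ m.
  have := @hoelder_ge0 (fun t => f t `^ p)%R (fun t => f t `^ (p / m))%R (m + 1)^-1
    (m / (m + 1))%R (mpow _) (mpow _) (fun x => powR_ge0 _ _) (fun x => powR_ge0 _ _).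
  move=> /(_ ltac:(by rewrite invr_gt0) ltac:(by rewrite divr_gt0)
            ltac:(by field; rewrite gt_eqF)) h.
  have -> : X * Y `^ m = (X `^ (m + 1)^-1 * Y `^ (m / (m + 1))) `^ (m + 1).
    rewrite (poweRM _ (poweR_ge0 _ _) (poweR_ge0 _ _)) -!poweRrM mulVf ?gt_eqF// poweRe1//.
    by rewrite divfK ?gt_eqF.
  apply: ge0_lee_poweR; first exact: ltW.
    by apply: integral_ge0 => x _; rewrite lee_fin.
  apply: le_trans h; rewrite le_eqVlt; apply/orP; left; apply/eqP.
  apply: eq_integral => x _; congr (_%:E).
  rewrite -!powRrM -powRD; last first.
    rewrite (_ : _ + _ = 1)%R ?oner_eq0// /p; field.
    by rewrite !gt_eqF.
  rewrite (_ : _ + _ = 1)%R ?powRr1// /p; field.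
  by rewrite !gt_eqF.
have step2 s : D s -> Y `^ m <= (K `^ (m - 1))%:E * \int[mu]_t (f t `^ p * w s t)%:E.
  move=> Ds; have mg : measurable_fun setT (fun t => f t `^ p * w s t)%R by exact: measurable_funM.
  have mh : measurable_fun setT (fun t => w s t `^ (- (m - 1)^-1))%R.
    by apply: measurable_fun_powR.
  have := @hoelder_ge0 (fun t => f t `^ p * w s t)%R (fun t => w s t `^ (- (m - 1)^-1))%R m^-1
    ((m - 1) / m)%R mg mh (fun t => mulr_ge0 (powR_ge0 _ _) (w0 _ _)) (fun x => powR_ge0 _ _).
  move=> /(_ ltac:(by rewrite invr_gt0) ltac:(by rewrite divr_gt0)
            ltac:(by field; rewrite gt_eqF)) h.
  set Z := \int[mu]_t _%:E in h *.
  set V := (\int[mu]_t (w s t `^ _)%:E) in h.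
  have Z0 : 0 <= Z by apply: integral_ge0 => x _; rewrite lee_fin mulr_ge0 ?powR_ge0.
  have V0 : 0 <= V by apply: integral_ge0 => x _; rewrite lee_fin powR_ge0.
  have YZV : Y <= Z `^ m^-1 * V `^ ((m - 1) / m).
    apply: le_trans h; apply: ae_ge0_le_integral => //.
    - by move=> x _; rewrite lee_fin powR_ge0.
    - exact/measurable_EFinP.
    - by move=> x _; rewrite lee_fin mulr_ge0 ?powR_ge0.
    - apply/measurable_EFinP; apply: measurable_funM; exact: measurable_fun_powR.
    (* Where [w s t] vanishes, its negative power is 0 by convention and the two powers do not
       cancel to 1; hence the comparison almost everywhere. *)
    apply: filterS (wae s Ds) => t wt _; rewrite lee_fin powRM ?powR_ge0// -!powRrM -mulrA.
    rewrite -powRD; last by rewrite wt implybT.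
    rewrite (_ : _ + _ = 0)%R ?powRr0 ?mulr1//; field.
    by rewrite !gt_eqF.
  have -> : (K `^ (m - 1))%:E * Z = (Z `^ m^-1 * K%:E `^ ((m - 1) / m)) `^ m.
    rewrite (poweRM _ (poweR_ge0 _ _) (poweR_ge0 _ _)) -!poweRrM mulVf ?gt_eqF// poweRe1//.
    by rewrite divfK ?gt_eqF// poweR_EFin muleC.
  apply: ge0_lee_poweR; [exact: ltW|exact: Y0|].
  apply: (le_trans YZV); apply: lee_wpmul2l; first exact: poweR_ge0.
  by apply: ge0_lee_poweR; [rewrite divr_ge0// ltW|exact: V0|exact: hK].
apply: (le_trans step1).
pose Z s := \int[mu]_t (f t `^ p * w s t)%:E.
have Z0 s : 0 <= Z s.
  by apply: integral_ge0 => x _; rewrite lee_fin mulr_ge0 ?powR_ge0.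
have fp0 s : 0 <= (f s `^ p)%:E by rewrite lee_fin powR_ge0.
have mfp : measurable_fun setT (fun s => (f s `^ p)%:E) by exact/measurable_EFinP.
have Km0 : 0 <= (K `^ (m - 1))%:E by rewrite lee_fin powR_ge0.
have mfZ : measurable_fun setT (fun s => (f s `^ p)%:E * Z s).
  exact: emeasurable_funM.
(* [Y^m] does not depend on [s], whereas its bound from [step2] does: averaging that bound against
   [f(s)^p] produces the double integral. *)
have XE : X * Y `^ m = \int[mu]_s ((f s `^ p)%:E * Y `^ m).
  by rewrite (ge0_integralZr mu measurableT mfp (fun s _ => fp0 s) (poweR_ge0 _ _)).
have ZE : (K `^ (m - 1))%:E * \int[mu]_s ((f s `^ p)%:E * Z s) =
    \int[mu]_s ((K `^ (m - 1))%:E * ((f s `^ p)%:E * Z s)).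
  by rewrite (ge0_integralZl mu measurableT mfZ (fun s _ => mule_ge0 (fp0 s) (Z0 s)) Km0).
rewrite XE ZE; apply: ae_ge0_le_integral.
- exact: measurableT.
- by move=> s _; rewrite mule_ge0 ?poweR_ge0.
- by apply: emeasurable_funM; [exact: mfp|exact: measurable_cst].
- by move=> s _; rewrite mule_ge0 ?mule_ge0.
- by apply: emeasurable_funM; [exact: measurable_cst|exact: mfZ].
apply: filterS Dae => s /step2 step2s _.
by rewrite muleCA; apply: lee_wpmul2l; [exact: fp0|exact: step2s].
Qed.

End hoelder_ge0.

(** * The phase and its Jacobian *)

Lemma lin1_mxZ (R : comNzRingType) m n (D : 'rV[R]_m -> 'rV[R]_n) a :
  lin1_mx (a \*: D) = a *: lin1_mx D.
Proof. by apply/matrixP => i j; rewrite !mxE. Qed.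

Section cube.
Context (R : realType) (n : nat).

Lemma measurable_cube : measurable (@cube R n).
Proof.
rewrite (_ : @cube R n = [set v : 'rV[R]_n | forall i, `[-1, 1]%classic (v ord0 i)]).
  by apply: (measurable_rV_box (A := fun=> `[-1, 1]%classic)).
by apply/seteqP; split => v h i; have := h i; rewrite /= in_itv.
Qed.

Lemma lebesgue_cube : (lebesgue_rV R n (@cube R n) = (2 ^+ n)%:E)%E.
Proof.
have -> : (@cube R n) = [set v : 'rV[R]_n | forall i, `[-1, 1]%classic (v ord0 i)].
  by apply/seteqP; split => v h i; have := h i; rewrite /= in_itv.
rewrite (@lebesgue_rV_itv R n (fun=> -1) (fun=> 1) true false); last by move=> i; lra.
by congr (_%:E); rewrite prodr_const card_ord opprK.
Qed.

Definition cube_sublevel (h : 'rV[R]_n -> R) (e : R) :=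
  [set t | @cube R n t /\ h t <= e].

Lemma measurable_cube_sublevel h e : measurable_fun setT h ->
  measurable (cube_sublevel h e).
Proof.
move=> mh; rewrite (_ : cube_sublevel h e = @cube R n `&` h @^-1` `]-oo, e]%classic).
  apply: measurableI; first exact: measurable_cube.
  by rewrite -[X in measurable X]setTI; exact: mh.
by apply/seteqP; split => t; rewrite /cube_sublevel/= in_itv.
Qed.

Local Open Scope ereal_scope.

Lemma lebesgue_half_shift_le (A B : set 'rV[R]_n) (s : 'rV[R]_n) :
  measurable A -> measurable B ->
  (forall t, A t -> B (2^-1 *: (t - s))%R) ->
  lebesgue_rV R n A <= (2 ^+ n)%:E * lebesgue_rV R n B.
Proof.
move=> mA mB AB; pose M : 'M[R]_n := (2^-1)%:M%R.
have dM : \det M = (2^-1 ^+ n)%R by rewrite det_scalar.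
have dM0 : \det M != 0%R by rewrite dM expf_neq0// invr_neq0.
have mM : measurable ((fun v => v *m M)%R @^-1` B).
  by rewrite -[X in measurable X]setTI; exact: measurable_mulmx_rV.
rewrite -(scales_lebesgue_unit dM0 mB) dM muleA -EFinM.
rewrite ger0_norm ?exprn_ge0 ?invr_ge0// -exprMn mulfV// expr1n mul1e.
rewrite -(lebesgue_rV_shift (- s)%R mM); apply: le_measure.
- exact/mem_set.
- by apply/mem_set; rewrite -[X in measurable X]setTI; exact: measurable_shift_rV mM.
by move=> t /AB; rewrite /preimage/= mul_mx_scalar.
Qed.

End cube.

Section phase.
Context (R : realType) (n : nat) (Phi : 'rV[R]_n * 'rV[R]_n -> 'rV[R]_n).
Hypothesis Phi_smooth : smooth Phi.
Hypothesis Phi_linear : forall x, linear (fun t => Phi (x, t)).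

Lemma phaseD x s t : Phi (x, s + t) = Phi (x, s) + Phi (x, t).
Proof. by have := Phi_linear x 1 s t; rewrite !scale1r. Qed.

Lemma phase0 x : Phi (x, 0) = 0.
Proof. by apply: (addrI (Phi (x, 0))); rewrite -phaseD !addr0. Qed.

Lemma phaseZ x a t : Phi (x, a *: t) = a *: Phi (x, t).
Proof. by have := Phi_linear x a t 0; rewrite !addr0 phase0 addr0. Qed.

Lemma phase_continuous : continuous Phi.
Proof. exact: (Phi_smooth 0). Qed.

Lemma phase_differentiable z : differentiable Phi z.
Proof. by have [] := Phi_smooth 1. Qed.

Lemma phase_diff_continuous v : continuous (fun z => 'd Phi z v).
Proof. by have [_] := Phi_smooth 1; exact. Qed.

Let slice_differentiable (x t : 'rV[R]_n) : differentiable (fun y : 'rV[R]_n => (y, t)) x.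
Proof. exact: differentiable_pair. Qed.

Lemma phase_slice_differentiable t x : differentiable (fun y => Phi (y, t)) x.
Proof.
apply: (@differentiable_comp _ _ _ _ (fun y => (y, t)) Phi) => //.
exact: phase_differentiable.
Qed.

(** Expressing the partial derivative through ['d Phi] is what makes the Jacobian jointly
    continuous, hence jointly measurable, in [x] and [t]. *)
Lemma phase_slice_diff t x v :
  'd (fun y => Phi (y, t)) x v = 'd Phi (x, t) (v, 0).
Proof.
rewrite (@diff_comp _ _ _ _ (fun y => (y, t)) Phi)//=; last exact: phase_differentiable.
have h : is_diff x (fun y : 'rV[R]_n => (y, t)) (fun v => (v, 0)).
  pose proof (is_diff_id x : is_diff x id id) as h1.
  pose proof (is_diff_cst t x : is_diff x (cst t) 0) as h2.
  exact: (is_diff_pair (f := id) (g := cst t)).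
by rewrite (@diff_val _ _ _ _ _ _ _ h).
Qed.

Lemma phase_slice_diff_continuous t v : continuous (fun x => 'd (fun y => Phi (y, t)) x v).
Proof.
under eq_fun do rewrite phase_slice_diff.
move=> x; apply: (@cvg_comp _ _ _ (fun x => (x, t)) (fun z => 'd Phi z (v, 0)) _
  (nbhs (x, t))); last exact: phase_diff_continuous.
exact: differentiable_continuous (slice_differentiable x t).
Qed.

Lemma JPhi_ge0 x t : 0 <= JPhi Phi x t. Proof. exact: normr_ge0. Qed.

Lemma measurable_JPhi :
  measurable_fun setT (fun z : 'rV[R]_n * 'rV[R]_n => JPhi Phi z.1 z.2).
Proof.
apply: measurableT_comp => //; apply: continuous_measurable_rV2.
apply: continuous_det => i j.
rewrite (_ : (fun _ => _) = (fun z => 'd Phi z (delta_mx 0 i, 0) ord0 j)).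
  apply: (continuous_coord_comp (f := fun z => 'd Phi z (delta_mx 0 i, 0))).
  exact: phase_diff_continuous.
by apply/funext => -[x t]; rewrite /jacobian /lin1_mx mxE phase_slice_diff.
Qed.

Lemma measurable_JPhi_slice x : measurable_fun setT (JPhi Phi x).
Proof. exact: (measurableT_comp measurable_JPhi (measurable_pair1 x)). Qed.

Lemma measurable_phase : measurable_fun setT Phi.
Proof.
apply: measurable_rVP => i; apply: continuous_measurable_rV2.
exact: (continuous_coord_comp (f := Phi)) phase_continuous.
Qed.

Lemma JPhiZ x a t : JPhi Phi x (a *: t) = `|a| ^+ n * JPhi Phi x t.
Proof.
rewrite /JPhi -normrX -normrM -detZ; congr (`| \det _ |).
rewrite /jacobian -lin1_mxZ; congr lin1_mx.
under [fun y => Phi (y, a *: t)]eq_fun do rewrite phaseZ.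
exact: (diffZ a (phase_slice_differentiable t x)).
Qed.

Local Open Scope ereal_scope.

Lemma phase_area_inequality (N : nat) (g : 'rV[R]_n -> \bar R) (w t : 'rV[R]_n) :
  (forall t c : 'rV[R]_n,
       ([set x | Phi (x, t) = c /\ JPhi Phi x t != 0%R] #<= `I_N)%card) ->
  measurable_fun setT g -> (forall y, 0 <= g y) ->
  \int[lebesgue_rV R n]_x (g (w + Phi (x, t))%R * (JPhi Phi x t)%:E) <=
    (2 ^+ n.+1 * N%:R)%:E * \int[lebesgue_rV R n]_y g y.
Proof.
move=> fib mg g0.
have mgw : measurable_fun setT (fun y : 'rV[R]_n => g (y + w)%R).
  by apply: (measurableT_comp mg); exact: measurable_shift_rV.
rewrite -(integral_shift_rV w mg g0).
under eq_integral do rewrite [(w + _)%R]addrC.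
apply: (area_inequality (psi := fun y => Phi (y, t))) => //.
- by move=> x; exact: phase_slice_differentiable.
- by move=> v; exact: phase_slice_diff_continuous.
Qed.

(* [(t - s)/2] stays in the cube and [J(x, (t - s)/2) <= J(x, t - s)]. *)
Lemma JPhi_sublevel_shift x (e : R) (s : 'rV[R]_n) : cube s ->
  lebesgue_rV R n (cube_sublevel (fun t => JPhi Phi x (t - s)%R) e) <=
  (2 ^+ n)%:E * lebesgue_rV R n (cube_sublevel (JPhi Phi x) e).
Proof.
move=> cs; apply: (lebesgue_half_shift_le (s := s)).
- apply: measurable_cube_sublevel.
  exact: (measurableT_comp (measurable_JPhi_slice x) (measurable_shift_rV (- s)%R)).
- exact: measurable_cube_sublevel (measurable_JPhi_slice x).
move=> t [ct Jt]; split.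
  by move=> i; rewrite !mxE; have := ct i; have := cs i; lra.
rewrite JPhiZ; apply: le_trans Jt; rewrite ler_piMl ?JPhi_ge0//.
by rewrite exprn_ile1// ger0_norm ?invr_ge0// invf_le1// ler1n.
Qed.

End phase.

(** * Sublevel estimates *)

Lemma powR_expVn (R : realType) (a b : R) k : 0 <= a ->
  (a ^- k) `^ b = (a `^ b) ^- k.
Proof. by move=> a0; rewrite -(powR_invn k a0) -(powR_invn k (powR_ge0 a b)) powRAC. Qed.

Section sublevel.
Local Open Scope ereal_scope.
Context d (T : measurableType d) (R : realType) (mu : {measure set T -> \bar R}).
Variables (h : T -> R) (C theta : R).
Hypotheses (mh : measurable_fun setT h) (h0 : forall t, (0 <= h t)%R).
Hypotheses (C0 : (0 <= C)%R) (theta0 : (0 < theta)%R).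
Hypothesis hC : forall e : R, (0 < e)%R ->
  mu [set t | (h t <= e)%R] <= (C * e `^ theta)%:E.

Let msub e : measurable [set t | (h t <= e)%R].
Proof.
rewrite (_ : mkset _ = h @^-1` `]-oo, e]%classic).
  by rewrite -[X in measurable X]setTI; exact: mh.
by apply/seteqP; split => t /=; rewrite in_itv.
Qed.

Lemma sublevel_ae_neq0 : {ae mu, forall t, h t != 0%R}.
Proof.
exists [set t | (h t <= 0)%R]; split; first exact: msub.
  apply/eqP; rewrite eq_le measure_ge0 andbT; apply/lee_addgt0Pr => e e0.
  have C10 : (0 < C + 1)%R by rewrite ltr_wpDl.
  (* Chosen so that [C * eta^theta <= e]; [C + 1] avoids dividing by zero. *)
  pose eta := ((e / (C + 1)) `^ theta^-1)%R.
  have eta0 : (0 < eta)%R by rewrite powR_gt0// divr_gt0.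
  have E : (eta `^ theta = e / (C + 1))%R.
    by rewrite /eta -powRrM mulVf ?gt_eqF// powRr1// divr_ge0// ltW.
  rewrite add0e; apply: (@le_trans _ _ (mu [set t | (h t <= eta)%R])).
    apply: le_measure; [exact/mem_set|exact/mem_set|].
    by move=> t /= /le_trans; apply; exact: ltW.
  apply: (le_trans (hC eta0)); rewrite lee_fin E mulrA ler_pdivrMr//.
  by rewrite mulrC ler_pM2l// lerDl.
by move=> t /= /negP; rewrite negbK => /eqP ->.
Qed.

(* On [2^-(k+1) < h <= 2^-k] the integrand is at most [2^(delta (k+1))]. *)
Lemma integral_powRN_le (V delta : R) :
  (0 <= delta < theta)%R -> mu setT <= V%:E ->
  \int[mu]_t (h t `^ (- delta))%:E <=
    (V + C * 2 `^ delta / (1 - 2 `^ delta / 2 `^ theta))%:E.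
Proof.
move=> /andP[d0 dt] muV.
pose u : R := (2 `^ delta)%R; pose v : R := (2 `^ theta)%R.
have u1 : (1 <= u)%R by rewrite -[X in (X <= _)%R](powRr0 2); apply: ler_powR => //; rewrite ler1n.
have uv : (u < v)%R by rewrite /u /v /powR pnatr_eq0/= ltr_expR ltr_pM2r// ln_gt0// ltr1n.
have u0 : (0 < u)%R by rewrite (lt_le_trans _ u1).
have v0 : (0 < v)%R by rewrite (lt_trans u0).
pose S k := [set t | (h t <= 2 ^- k)%R].
pose F k t : \bar R := (u ^+ k.+1 * \1_(S k) t)%:E.
have F0 k t : 0 <= F k t by rewrite lee_fin mulr_ge0// exprn_ge0// ltW.
have mF k : measurable_fun setT (F k).
  apply/measurable_EFinP; apply: measurable_funM => //.
  by apply: measurable_indic; exact: msub.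
have pt t : (h t `^ (- delta))%:E <= 1 + \sum_(k <oo) F k t.
  have S0 : 0 <= \sum_(k <oo) F k t by apply: nneseries_ge0.
  have [h1|h1] := leP 1%R (h t).
    apply: (@le_trans _ _ 1%:E); last by rewrite leeDl.
    rewrite lee_fin powRN invf_le1 ?powR_gt0 ?(lt_le_trans _ h1)//.
    by rewrite -[X in (X <= _)%R](powRr0 (h t)); apply: ler_powR.
  (* By convention a power of 0 is 0 or 1, so zeros of [h] are absorbed by the summand 1. *)
  have [h00|hn0] := eqVneq (h t) 0%R.
    apply: (@le_trans _ _ 1%:E); last by rewrite leeDl.
    by rewrite h00 lee_fin /powR eqxx; case: (_ == _).
  have hp : (0 < h t)%R by rewrite lt_neqAle eq_sym hn0 h0.
  have ex : exists k, (2 ^- k < h t)%R.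
    have [k _ /(_ k (leqnn k))/= hk] := near_infty_natSinv_expn_lt (PosNum hp).
    by exists k; rewrite -[X in (X < _)%R]mul1r.
  (* The least exponent is [k + 1], positive because [h t < 1]; minimality gives [h t <= 2^-k]. *)
  case: (ex_minnP ex) => -[|k] hk kmin.
    by move: hk; rewrite expr0 invr1 => /(lt_trans h1); rewrite ltxx.
  have Sk : S k t.
    by rewrite /S/= leNgt; apply/negP => /kmin; rewrite ltnn.
  apply: (@le_trans _ _ (F k t)); last first.
    apply: (@le_trans _ _ (\sum_(j <oo) F j t)); last by rewrite leeDr.
    by rewrite (nneseriesD1 (n := k))// leeDl// nneseries_ge0.
  rewrite /F indicE mem_set// mulr1 lee_fin powRN -[leRHS]invrK lef_pV2 ?posrE.
  - rewrite -(powR_expVn delta k.+1 (ler0n R 2)).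
    by apply: ge0_ler_powR; rewrite ?nnegrE ?invr_ge0 ?exprn_ge0// ltW.
  - by rewrite powR_gt0.
  - by rewrite invr_gt0 exprn_gt0.
apply: (@le_trans _ _ (\int[mu]_t (1 + \sum_(k <oo) F k t))).
  apply: ge0_le_integral => //.
  - by move=> t _; rewrite lee_fin powR_ge0.
  - by apply/measurable_EFinP; exact: measurable_fun_powR.
  - by apply: emeasurable_funD => //; apply: ge0_emeasurable_sum.
rewrite ge0_integralD//; last 2 first.
- by move=> t _; exact: nneseries_ge0.
- exact: ge0_emeasurable_sum.
rewrite integral_cst// mul1e EFinD; apply: leeD => //.
rewrite integral_nneseries//.
have z1 : (u / v < 1)%R by rewrite ltr_pdivrMr// mul1r.
have z0 : (0 <= u / v)%R by rewrite divr_ge0 ?ltW.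
have omz : (0 < 1 - u / v)%R by rewrite subr_gt0.
(* The sublevel bound at [2^-k] is [C v^-k], against a height [u^(k+1)]; the ratio [u / v] is below
   1 because [delta < theta]. *)
apply: (@le_trans _ _ (\sum_(k <oo) (C * u * (u / v) ^+ k)%:E)).
  apply: lee_nneseries => [k _ _|k _]; first exact: integral_ge0.
  have uk0 : 0 <= (u ^+ k.+1)%:E by rewrite lee_fin exprn_ge0// ltW.
  have mS : measurable_fun setT (fun t => (\1_(S k) t)%:E : \bar R).
    by apply/measurable_EFinP; apply: measurable_indic; exact: msub.
  have -> : \int[mu]_t F k t = (u ^+ k.+1)%:E * \int[mu]_t (\1_(S k) t)%:E.
    rewrite -(ge0_integralZl mu measurableT mS _ uk0); first by [].
    by move=> t _; rewrite lee_fin.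
  rewrite integral_indic//; last exact: msub.
  rewrite setIT; apply: (le_trans (lee_wpmul2l _ (hC (e := 2 ^- k) _))).
  - by rewrite lee_fin exprn_ge0// ltW.
  - by rewrite invr_gt0 exprn_gt0.
  rewrite -EFinM lee_fin.
  rewrite (powR_expVn theta k (ler0n R 2)) -/v.
  by rewrite exprS expr_div_n le_eqVlt; apply/orP; left; apply/eqP; ring.
apply: lime_le.
  apply: is_cvg_nneseries => k _ _.
  by rewrite lee_fin mulr_ge0 ?exprn_ge0// mulr_ge0// ltW.
apply: nearW => k; rewrite sumEFin lee_fin.
have := @geometric_seriesE R (C * u) (u / v); rewrite lt_eqF// => /(_ isT).
move=> /(congr1 (fun f => f k)) /= E.
rewrite /series/= in E; rewrite [leLHS]E ler_pM2r ?invr_gt0//.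
by apply: ler_piMr; [exact: mulr_ge0 C0 (ltW u0)|rewrite gerBl exprn_ge0].
Qed.

End sublevel.

(** * The bilinear estimate *)

Lemma sigma_finite_product d1 d2 (T1 : measurableType d1) (T2 : measurableType d2)
    (R : realType) (m1 : {sigma_finite_measure set T1 -> \bar R})
    (m2 : {sigma_finite_measure set T2 -> \bar R}) :
  sigma_finite setT (m1 \x m2)%E.
Proof.
have /sigma_finiteP[F [FT ndF mF]] := sigma_finiteT m1.
have /sigma_finiteP[G [GT ndG mG]] := sigma_finiteT m2.
exists (fun k => F k `*` G k).
  apply/esym/seteqP; split=> // z _.
  have [a _ Fa] : (\bigcup_i F i) z.1 by rewrite -FT.
  have [b _ Gb] : (\bigcup_i G i) z.2 by rewrite -GT.
  exists (maxn a b) => //; split.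
    by move: Fa; exact/subsetPset/ndF/leq_maxl.
  by move: Gb; exact/subsetPset/ndG/leq_maxr.
move=> k; have [mFk Fkoo] := mF k; have [mGk Gkoo] := mG k; split.
  exact: measurableX.
by rewrite product_measure1E// lte_mul_pinfty// ge0_fin_numE.
Qed.

(* For [m2 \x m3] the library infers a sigma-finite structure only when m2 and
   m3 are subprobabilities, which is why the structure is packed by hand. *)
Lemma fubini_tonelli_prod d1 d2 d3 (T1 : measurableType d1)
    (T2 : measurableType d2) (T3 : measurableType d3) (R : realType)
    (m1 : {sigma_finite_measure set T1 -> \bar R})
    (m2 : {sigma_finite_measure set T2 -> \bar R})
    (m3 : {sigma_finite_measure set T3 -> \bar R}) (Q : T1 * (T2 * T3) -> \bar R) :
  measurable_fun setT Q -> (forall v, 0 <= Q v)%E ->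
  (\int[m1]_x \int[m2 \x m3]_w Q (x, w) = \int[m2 \x m3]_w \int[m1]_x Q (x, w))%E.
Proof.
move=> mQ Q0.
pose m23 : {sigma_finite_measure set (T2 * T3)%type -> \bar R} :=
  HB.pack (m2 \x m3)%E (Measure_isSigmaFinite.Build _ _ _ (m2 \x m3)%E
    (sigma_finite_product m2 m3)).
exact: (fubini_tonelli (m1 := m1) (m2 := m23)).
Qed.

Section shear_integrals.
Local Open Scope ereal_scope.
Context (R : realType) (n : nat) (Phi : 'rV[R]_n * 'rV[R]_n -> 'rV[R]_n).
Hypothesis Phi_smooth : smooth Phi.
Hypothesis Phi_linear : forall x, linear (fun t => Phi (x, t)).

Local Notation lam := (lebesgue_rV R n).

Lemma measurable_funD_rV d (T : measurableType d) (f g : T -> 'rV[R]_n) :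
  measurable_fun setT f -> measurable_fun setT g ->
  measurable_fun setT (fun x => f x + g x)%R.
Proof.
move=> mf mg; apply: measurable_rVP => i; under eq_fun do rewrite mxE.
by apply: measurable_funD; apply: (measurableT_comp (measurable_coord i)).
Qed.

Lemma measurable_phase_comp d (T : measurableType d) (f g : T -> 'rV[R]_n) :
  measurable_fun setT f -> measurable_fun setT g ->
  measurable_fun setT (fun x => Phi (f x, g x)).
Proof.
move=> mf mg; apply: (measurableT_comp (measurable_phase Phi_smooth)).
exact: measurable_fun_pair.
Qed.

Lemma measurable_JPhi_comp d (T : measurableType d) (f g : T -> 'rV[R]_n) :
  measurable_fun setT f -> measurable_fun setT g ->
  measurable_fun setT (fun x => JPhi Phi (f x) (g x)).
Proof.
move=> mf mg.
apply: (measurableT_comp (measurable_JPhi Phi_smooth) (measurable_fun_pair mf mg)).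
Qed.

Lemma measurable_comp_pair d (T : measurableType d) (P : 'rV[R]_n * 'rV[R]_n -> \bar R)
    (f g : T -> 'rV[R]_n) :
  measurable_fun setT P -> measurable_fun setT f -> measurable_fun setT g ->
  measurable_fun setT (fun x => P (f x, g x)).
Proof.
move=> mP mf mg; exact: (measurableT_comp mP (measurable_fun_pair mf mg)).
Qed.

Lemma integral_shiftl_rV (a : 'rV[R]_n) (h : 'rV[R]_n -> \bar R) :
  measurable_fun setT h -> (forall y, 0 <= h y) ->
  \int[lam]_x h (a + x)%R = \int[lam]_x h x.
Proof.
move=> mh h0; rewrite -(integral_shift_rV a mh h0).
by apply: eq_integral => x _; rewrite addrC.
Qed.

(** With [x] fixed, integrating in [x'] first makes [Phi (x, t)] a constant translation; what is
    left is the translation of [t] by [x]. *)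
Lemma integral_slice_shear (P : 'rV[R]_n * 'rV[R]_n -> \bar R) (x : 'rV[R]_n) :
  measurable_fun setT P -> (forall z, 0 <= P z) ->
  \int[lam]_x' \int[lam]_t P (x + t, x' + Phi (x, t))%R = \int[lebesgue_rV2 R n]_z P z.
Proof.
move=> mP P0.
have mf := @measurable_fst _ _ 'rV[R]_n 'rV[R]_n; have ms := @measurable_snd _ _ 'rV[R]_n 'rV[R]_n.
have mx : measurable_fun setT (fun _ : 'rV[R]_n * 'rV[R]_n => x) by exact: measurable_cst.
have mQ : measurable_fun setT (fun z : 'rV[R]_n * 'rV[R]_n =>
    P (x + z.2, z.1 + Phi (x, z.2))%R).
  apply: measurable_comp_pair => //; apply: measurable_funD_rV => //.
  exact: measurable_phase_comp.
rewrite (fubini_tonelli (m1 := lam) (m2 := lam) (fun z => P (x + z.2, z.1 + Phi (x, z.2))%R))//=.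
rewrite /lebesgue_rV2 (fubini_tonelli1 (m1 := lam) (m2 := lam))//.
have mG : measurable_fun setT (fun y => \int[lam]_v P (y, v)).
  exact: (measurable_fun_fubini_tonelli_F (m2 := lam) P mP P0).
transitivity (\int[lam]_t (fun y => \int[lam]_v P (y, v)) (x + t)%R); last first.
  by rewrite (integral_shiftl_rV x mG)// => y; exact: integral_ge0.
apply: eq_integral => t _; rewrite (integral_shift_rV _ (h := fun y => P (x + t, y)%R))//.
exact: (measurableT_comp mP (measurable_pair1 (x + t)%R)).
Qed.

(** [Q] keeps the original [x] as a separate argument while the sheared point becomes a free
    variable [w]: the weight still depends on [x] after the base point has moved. *)
Lemma integral_shear_family (Q : 'rV[R]_n * ('rV[R]_n * 'rV[R]_n) -> \bar R) :
  measurable_fun setT Q -> (forall v, 0 <= Q v) ->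
  \int[lebesgue_rV2 R n]_z \int[lam]_s Q (z.1, shear Phi z s) =
  \int[lam]_x \int[lebesgue_rV2 R n]_w Q (x, w).
Proof.
move=> mQ Q0.
have m1 : measurable_fun setT (fun u : ('rV[R]_n * 'rV[R]_n) * 'rV[R]_n => u.1.1).
  exact: (measurableT_comp measurable_fst measurable_fst).
have m2 : measurable_fun setT (fun u : ('rV[R]_n * 'rV[R]_n) * 'rV[R]_n => u.1.2).
  exact: (measurableT_comp measurable_snd measurable_fst).
have m3 : measurable_fun setT
    (fun u : ('rV[R]_n * 'rV[R]_n) * 'rV[R]_n => shear Phi u.1 u.2).
  apply: measurable_fun_pair; apply: measurable_funD_rV => //.
  exact: measurable_phase_comp.
have mQs := measurableT_comp mQ (measurable_fun_pair m1 m3).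
have mI := measurable_fun_fubini_tonelli_F (m2 := lam) _ mQs (fun u => Q0 _).
have I0 (z : 'rV[R]_n * 'rV[R]_n) : 0 <= \int[lam]_s Q (z.1, shear Phi z s).
  by apply: integral_ge0.
rewrite [LHS](fubini_tonelli1 (m1 := lam) (m2 := lam) _ mI I0).
apply: eq_integral => x _.
have mQx : measurable_fun setT (fun w => Q (x, w)).
  exact: (measurableT_comp mQ (measurable_pair1 x)).
exact: (integral_slice_shear x mQx (fun w => Q0 (x, w))).
Qed.

End shear_integrals.

Section bilinear.
Local Open Scope ereal_scope.
Context (R : realType) (n : nat) (Phi : 'rV[R]_n * 'rV[R]_n -> 'rV[R]_n).
Hypothesis Phi_smooth : smooth Phi.
Hypothesis Phi_linear : forall x, linear (fun t => Phi (x, t)).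

Local Notation lam := (lebesgue_rV R n).

Lemma integral_shear_area (N : nat) (F : 'rV[R]_n * 'rV[R]_n -> \bar R) w :
  (forall t c : 'rV[R]_n,
     ([set x | Phi (x, t) = c /\ JPhi Phi x t != 0%R] #<= `I_N)%card) ->
  measurable_fun setT F -> (forall z, 0 <= F z) ->
  \int[lam]_x \int[lam]_t (F (w.1 + t, w.2 + Phi (x, t))%R * (JPhi Phi x t)%:E) <=
  (2 ^+ n.+1 * N%:R)%:E * \int[lebesgue_rV2 R n]_z F z.
Proof.
move=> fib mF F0.
set c := (2 ^+ n.+1 * N%:R)%R.
have c0 : 0 <= c%:E by rewrite lee_fin mulr_ge0// exprn_ge0.
pose h (u : 'rV[R]_n * 'rV[R]_n) :=
  F (w.1 + u.2, w.2 + Phi (u.1, u.2))%R * (JPhi Phi u.1 u.2)%:E.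
have mh : measurable_fun setT h.
  apply: emeasurable_funM.
    apply: measurable_comp_pair => //; apply: measurable_funD_rV => //.
    exact: (measurable_phase_comp Phi_smooth).
  by apply/measurable_EFinP; exact: (measurable_JPhi_comp Phi_smooth).
have h0 u : 0 <= h u by rewrite mule_ge0 ?lee_fin ?JPhi_ge0.
rewrite (fubini_tonelli (m1 := lam) (m2 := lam) h mh h0).
pose Fs (y : 'rV[R]_n) := \int[lam]_v F (y, v).
have mFs : measurable_fun setT Fs.
  exact: (measurable_fun_fubini_tonelli_F (m2 := lam) F mF F0).
have Fs0 y : 0 <= Fs y by exact: integral_ge0.
have -> : \int[lebesgue_rV2 R n]_z F z = \int[lam]_t Fs (w.1 + t)%R.
  by rewrite (integral_shiftl_rV w.1 mFs Fs0) /lebesgue_rV2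
    (fubini_tonelli1 (m1 := lam) (m2 := lam) F mF F0).
have mFw : measurable_fun setT (fun t => Fs (w.1 + t)%R).
  by apply: (measurableT_comp mFs); exact: measurable_funD_rV.
rewrite -(ge0_integralZl lam measurableT mFw (fun t _ => Fs0 _) c0).
apply: ge0_le_integral => //.
- by move=> t _; exact: integral_ge0.
- exact: (measurable_fun_fubini_tonelli_G (m1 := lam) h mh h0).
- exact: measurable_funeM.
move=> t _.
apply: (phase_area_inequality Phi_smooth (g := fun y => F (w.1 + t, y)%R)) => //.
exact: (measurableT_comp mF (measurable_pair1 (w.1 + t)%R)).
Qed.

Let G (F : 'rV[R]_n * 'rV[R]_n -> \bar R) x (w : 'rV[R]_n * 'rV[R]_n) t :=
  F (w.1 + t, w.2 + Phi (x, t))%R * (JPhi Phi x t)%:E.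

Lemma integral_bilinear_shear (N : nat) (F : 'rV[R]_n * 'rV[R]_n -> \bar R) :
  (forall t c : 'rV[R]_n,
     ([set x | Phi (x, t) = c /\ JPhi Phi x t != 0%R] #<= `I_N)%card) ->
  measurable_fun setT F -> (forall z, 0 <= F z) ->
  \int[lebesgue_rV2 R n]_z \int[lam]_s (F (shear Phi z s) *
      \int[lam]_t (F (shear Phi z t) * (JPhi Phi z.1 (t - s)%R)%:E)) <=
  (2 ^+ n.+1 * N%:R)%:E *
    ((\int[lebesgue_rV2 R n]_z F z) * \int[lebesgue_rV2 R n]_z F z).
Proof.
move=> fib mF F0.
pose H (u : ('rV[R]_n * ('rV[R]_n * 'rV[R]_n)) * 'rV[R]_n) := G F u.1.1 u.1.2 u.2.
have H0 u : 0 <= H u by rewrite /H /G mule_ge0 ?lee_fin ?JPhi_ge0.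
have mx : measurable_fun setT (fun u : ('rV[R]_n * ('rV[R]_n * 'rV[R]_n)) * 'rV[R]_n => u.1.1).
  exact: (measurableT_comp measurable_fst measurable_fst).
have mw : measurable_fun setT (fun u : ('rV[R]_n * ('rV[R]_n * 'rV[R]_n)) * 'rV[R]_n => u.1.2).
  exact: (measurableT_comp measurable_snd measurable_fst).
have mt : measurable_fun setT (fun u : ('rV[R]_n * ('rV[R]_n * 'rV[R]_n)) * 'rV[R]_n => u.2).
  exact: measurable_snd.
have mH : measurable_fun setT H.
  apply: emeasurable_funM.
    apply: measurable_comp_pair => //; apply: measurable_funD_rV => //.
    - exact: (measurableT_comp measurable_fst mw).
    - exact: (measurableT_comp measurable_snd mw).
    - exact: (measurable_phase_comp Phi_smooth).
  by apply/measurable_EFinP; exact: (measurable_JPhi_comp Phi_smooth).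
pose K (v : 'rV[R]_n * ('rV[R]_n * 'rV[R]_n)) := \int[lam]_t H (v, t).
have mK : measurable_fun setT K.
  exact: (measurable_fun_fubini_tonelli_F (m2 := lam) H mH H0).
have K0 v : 0 <= K v by exact: integral_ge0.
(* After replacing [t] by [t + s], additivity of [Phi (x, _)] shows that [s] enters only through the
   sheared point. *)
have inner z s : \int[lam]_t (F (shear Phi z t) * (JPhi Phi z.1 (t - s)%R)%:E) =
    K (z.1, shear Phi z s).
  rewrite -(integral_shift_rV s); last 2 first.
  - apply: emeasurable_funM.
      apply: measurable_comp_pair => //; apply: measurable_funD_rV => //.
      exact: (measurable_phase_comp Phi_smooth).
    apply/measurable_EFinP; apply: (measurable_JPhi_comp Phi_smooth) => //.
    exact: measurable_shift_rV.
  - by move=> y; rewrite mule_ge0 ?lee_fin ?JPhi_ge0.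
  apply: eq_integral => t _; rewrite /H /G /shear /= addrK phaseD//.
  congr (F (_, _) * _); first by rewrite [(t + s)%R]addrC addrA.
  by rewrite [(Phi _ + _)%R]addrC addrA.
under eq_integral do under eq_integral do rewrite inner.
pose Q v := F v.2 * K v.
have mQ : measurable_fun setT Q.
  by apply: emeasurable_funM => //; exact: (measurableT_comp mF measurable_snd).
have Q0 v : 0 <= Q v by rewrite mule_ge0.
rewrite (integral_shear_family Phi_smooth mQ Q0).
(* Now [w] is held fixed and [x] is integrated first, so that [F w] comes out and the area
   inequality bounds the rest uniformly in [w]. *)
rewrite (fubini_tonelli_prod _ _ _ mQ Q0) -/(lebesgue_rV2 R n).
set c := (2 ^+ n.+1 * N%:R)%R; set I := \int[lebesgue_rV2 R n]_z F z.
have c0 : 0 <= c%:E by rewrite lee_fin mulr_ge0// exprn_ge0.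
have I0 : 0 <= I by exact: integral_ge0.
have KI w : \int[lam]_x K (x, w) <= c%:E * I by exact: (integral_shear_area w fib mF F0).
have -> : c%:E * (I * I) = \int[(lebesgue_rV2 R n)]_w (F w * (c%:E * I)).
  rewrite (ge0_integralZr (lebesgue_rV2 R n) measurableT mF (fun w _ => F0 w)) ?mule_ge0//.
  by rewrite muleCA.
apply: ge0_le_integral => //.
- by move=> w _; exact: integral_ge0.
- exact: (measurable_fun_fubini_tonelli_G (m1 := lam) Q mQ Q0).
- by apply: emeasurable_funM => //; exact: measurable_cst.
move=> w _; rewrite /Q /=.
have mKw : measurable_fun setT (fun x => K (x, w)).
  exact: (measurableT_comp mK (measurable_pair2 w)).
rewrite (ge0_integralZl lam measurableT mKw (fun x _ => K0 (x, w)) (F0 w)).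
by apply: lee_wpmul2l => //; exact: KI.
Qed.

End bilinear.

(** * The averaging operator *)

Lemma measurable_integral_slice d1 d2 (T1 : measurableType d1) (T2 : measurableType d2)
    (R : realType) (mu : {sigma_finite_measure set T2 -> \bar R}) (D : set T2)
    (h : T1 * T2 -> \bar R) :
  measurable D -> measurable_fun setT h -> (forall z, 0 <= h z)%E ->
  measurable_fun setT (fun x => \int[mu]_(y in D) h (x, y))%E.
Proof.
move=> mD mh h0.
have mD' : measurable ([set: T1] `*` D) by exact: measurableX.
have mg : measurable_fun setT (h \_ ([set: T1] `*` D)).
  by apply/(measurable_restrictT _ mD'); exact: measurable_funTS mh.
have g0 z : (0 <= (h \_ ([set: T1] `*` D)) z)%E by rewrite patchE; case: ifP.
have := measurable_fun_fubini_tonelli_F (m2 := mu) _ mg g0.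
congr measurable_fun; apply/funext => x; rewrite [RHS]integral_mkcond.
apply: eq_integral => y _; rewrite !patchE; congr (if _ then _ else _).
by rewrite in_setX in_setT.
Qed.

Lemma measurable_oppr_rV (R : realType) n : measurable_fun setT (fun x : 'rV[R]_n => - x).
Proof.
apply: measurable_rVP => i; under eq_fun do rewrite mxE.
exact: (measurable_funN (measurable_coord i)).
Qed.

Lemma measurable_shear (R : realType) n (Phi : 'rV[R]_n * 'rV[R]_n -> 'rV[R]_n) :
  smooth Phi ->
  measurable_fun setT
    (fun u : ('rV[R]_n * 'rV[R]_n) * 'rV[R]_n => shear Phi u.1 u.2).
Proof.
move=> Phi_smooth.
have m1 : measurable_fun setT (fun u : ('rV[R]_n * 'rV[R]_n) * 'rV[R]_n => u.1.1).
  exact: (measurableT_comp measurable_fst measurable_fst).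
have m2 : measurable_fun setT (fun u : ('rV[R]_n * 'rV[R]_n) * 'rV[R]_n => u.1.2).
  exact: (measurableT_comp measurable_snd measurable_fst).
apply: measurable_fun_pair; apply: measurable_funD_rV => //.
exact: (measurable_phase_comp Phi_smooth).
Qed.

(** * The pointwise bound and its integral *)

Section kernel.
Local Open Scope ereal_scope.
Context (R : realType) (n : nat) (Phi : 'rV[R]_n * 'rV[R]_n -> 'rV[R]_n).
Hypothesis Phi_smooth : smooth Phi.
Hypothesis Phi_linear : forall x, linear (fun t => Phi (x, t)).
Hypothesis J_sublevel : forall theta : R, (0 <= theta < 1)%R ->
  exists C : R, forall (x : 'rV[R]_n) (e : R), (0 < e)%R ->
    lebesgue_rV R n [set t | cube t /\ (JPhi Phi x t <= e)%R] <= (C * e `^ theta)%:E.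

Local Notation lam := (lebesgue_rV R n).
Local Notation mu := (mrestr lam (@measurable_cube R n)).

Lemma ae_cube : {ae mu, forall s, @cube R n s}.
Proof.
exists (~` @cube R n); split => //; first exact: measurableC (@measurable_cube R n).
by rewrite /mrestr setICl measure0.
Qed.

Lemma kernel_bound (delta : R) : (0 <= delta < 1)%R ->
  exists2 K : R, (0 <= K)%R & forall x s, @cube R n s ->
    {ae mu, forall t, JPhi Phi x (t - s)%R != 0%R} /\
    \int[mu]_t (JPhi Phi x (t - s)%R `^ (- delta))%:E <= K%:E.
Proof.
(* An order strictly between [delta] and 1, so that the sublevel hypothesis applies and the dyadic
   series converges. *)
move=> /andP[d0 d1]; pose theta := ((delta + 1) / 2)%R.
have dt : (delta < theta)%R by rewrite /theta; lra.
have t0 : (0 < theta)%R by apply: le_lt_trans dt.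
have t1 : (theta < 1)%R by rewrite /theta; lra.
have [|C hC] := J_sublevel (theta := theta); first by rewrite (ltW t0) t1.
have C0 : (0 <= C)%R.
  have := hC 0%R 1%R ltr01; rewrite powR1 mulr1 => h.
  by rewrite -lee_fin; exact: le_trans h.
(* The factor [2^n] is the price of shifting the sublevel sets by [s]. *)
pose C' := (2 ^+ n * C)%R.
have C'0 : (0 <= C')%R by rewrite mulr_ge0// exprn_ge0.
have d12 : (2 `^ delta < 2 `^ theta)%R.
  by rewrite /powR pnatr_eq0/= ltr_expR ltr_pM2r// ln_gt0// ltr1n.
pose K := (2 ^+ n + C' * 2 `^ delta / (1 - 2 `^ delta / 2 `^ theta))%R.
exists K.
  rewrite addr_ge0 ?exprn_ge0// divr_ge0 ?mulr_ge0 ?powR_ge0//.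
  by rewrite subr_ge0 ler_pdivrMr ?powR_gt0// mul1r ltW.
move=> x s cs.
have mh : measurable_fun setT (fun t : 'rV[R]_n => JPhi Phi x (t - s)%R).
  exact: (measurableT_comp (measurable_JPhi_slice Phi_smooth x) (measurable_shift_rV (- s)%R)).
have h0 t : (0 <= JPhi Phi x (t - s)%R)%R by exact: JPhi_ge0.
have hs e : (0 < e)%R -> mu [set t | (JPhi Phi x (t - s)%R <= e)%R] <= (C' * e `^ theta)%:E.
  move=> e0; rewrite /mrestr setIC.
  rewrite -[X in lam X <= _]/(cube_sublevel (fun t => JPhi Phi x (t - s)%R) e).
  apply: (le_trans (JPhi_sublevel_shift Phi_smooth Phi_linear x e cs)).
  rewrite /C' -mulrA EFinM lee_wpmul2l// ?lee_fin ?exprn_ge0//.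
  exact: hC.
split; first exact: (@sublevel_ae_neq0 _ _ R mu _ _ _ mh C'0 t0 hs).
apply: (@integral_powRN_le _ _ R mu _ _ _ mh h0 C'0 hs); first by rewrite d0 dt.
by rewrite -[leLHS]/(lam ([set: 'rV[R]_n] `&` @cube R n)) setTI lebesgue_cube.
Qed.

(** The cube serves the pointwise bound, through the integrability of the negative power. Afterwards
    both cutoffs are dropped, the integrands being nonnegative, since the bilinear estimate
    translates [s] and [t] over the whole space. *)
Lemma integral_averaging_powR_le (N : nat) (m : R) :
  (forall t c : 'rV[R]_n,
     ([set x | Phi (x, t) = c /\ JPhi Phi x t != 0%R] #<= `I_N)%card) ->
  (2 < m)%R ->
  exists2 A : R, (0 <= A)%R & forall f : 'rV[R]_n * 'rV[R]_n -> R,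
    measurable_fun setT f -> (forall z, 0 <= f z)%R ->
    \int[lebesgue_rV2 R n]_z (\int[lam]_(t in @cube R n) (f (shear Phi z t))%:E) `^ (m + 1) <=
    A%:E * ((\int[lebesgue_rV2 R n]_z (f z `^ ((m + 1) / 2))%:E) *
            \int[lebesgue_rV2 R n]_z (f z `^ ((m + 1) / 2))%:E).
Proof.
move=> fib m2.
have m1 : (1 < m)%R by lra.
have [|K K0 hK] := kernel_bound (delta := (m - 1)^-1%R).
  by rewrite invr_ge0 subr_ge0 (ltW m1) invf_lt1; lra.
have KA : (0 <= K `^ (m - 1) * (2 ^+ n.+1 * N%:R))%R.
  by rewrite mulr_ge0 ?powR_ge0// mulr_ge0// exprn_ge0.
exists (K `^ (m - 1) * (2 ^+ n.+1 * N%:R))%R => // f mf f0.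
pose r := ((m + 1) / 2)%R.
pose F (z : 'rV[R]_n * 'rV[R]_n) := (f z `^ r)%:E.
have mF : measurable_fun setT F.
  by apply/measurable_EFinP; exact: measurable_fun_powR.
have F0 z : 0 <= F z by rewrite lee_fin powR_ge0.
pose H (v : ('rV[R]_n * 'rV[R]_n) * 'rV[R]_n * 'rV[R]_n) :=
  F (shear Phi v.1.1 v.2) * (JPhi Phi v.1.1.1 (v.2 - v.1.2)%R)%:E.
have H0 v : 0 <= H v.
  by apply: mule_ge0; [exact: F0|rewrite lee_fin; exact: JPhi_ge0].
have mz : measurable_fun setT
    (fun v : ('rV[R]_n * 'rV[R]_n) * 'rV[R]_n * 'rV[R]_n => v.1.1).
  exact: (measurableT_comp measurable_fst measurable_fst).
have ms : measurable_fun setT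
    (fun v : ('rV[R]_n * 'rV[R]_n) * 'rV[R]_n * 'rV[R]_n => v.1.2).
  exact: (measurableT_comp measurable_snd measurable_fst).
have mx : measurable_fun setT
    (fun v : ('rV[R]_n * 'rV[R]_n) * 'rV[R]_n * 'rV[R]_n => v.1.1.1).
  exact: (measurableT_comp measurable_fst mz).
have mshear d (T : measurableType d) (a : T -> 'rV[R]_n * 'rV[R]_n) (b : T -> 'rV[R]_n) :
    measurable_fun setT a -> measurable_fun setT b ->
    measurable_fun setT (fun u => shear Phi (a u) (b u)).
  move=> ma mb; apply: (measurableT_comp (measurable_shear Phi_smooth) (measurable_fun_pair ma mb)).
have mdiff : measurable_fun setT
    (fun v : ('rV[R]_n * 'rV[R]_n) * 'rV[R]_n * 'rV[R]_n => v.2 - v.1.2)%R.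
  apply: measurable_funD_rV => //.
  exact: (measurableT_comp (measurable_oppr_rV (n:=n)) ms).
have mH : measurable_fun setT H.
  apply: emeasurable_funM.
    by apply: (measurableT_comp mF); exact: mshear.
  by apply/measurable_EFinP; exact: (measurable_JPhi_comp Phi_smooth).
pose I (u : ('rV[R]_n * 'rV[R]_n) * 'rV[R]_n) := \int[lam]_t H (u, t).
have mI : measurable_fun setT I.
  exact: (measurable_fun_fubini_tonelli_F (m2 := lam) H mH H0).
have I0 u : 0 <= I u by apply: integral_ge0 => t _; exact: H0.
pose B z := \int[lam]_s (F (shear Phi z s) * I (z, s)).
have mFI : measurable_fun setT (fun u : ('rV[R]_n * 'rV[R]_n) * 'rV[R]_n =>
    F (shear Phi u.1 u.2) * I u).
  by apply: emeasurable_funM => //; apply: (measurableT_comp mF); exact: mshear.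
have FI0 u : 0 <= F (shear Phi u.1 u.2) * I u by rewrite mule_ge0.
have mB : measurable_fun setT B.
  exact: (measurable_fun_fubini_tonelli_F (m2 := lam) _ mFI FI0).
have B0 z : 0 <= B z by apply: integral_ge0 => s _; exact: (FI0 (z, s)).
have pt z : (\int[lam]_(t in @cube R n) (f (shear Phi z t))%:E) `^ (m + 1) <=
    (K `^ (m - 1))%:E * B z.
  pose g t := f (shear Phi z t).
  have mg : measurable_fun setT g.
    by apply: (measurableT_comp mf); apply: mshear => //; exact: measurable_cst.
  pose w s t := JPhi Phi z.1 (t - s)%R.
  have mw : measurable_fun setT (fun v : 'rV[R]_n * 'rV[R]_n => w v.1 v.2).
    apply: (measurable_JPhi_comp Phi_smooth) => //; apply: measurable_funD_rV => //.
    exact: (measurableT_comp (measurable_oppr_rV (n:=n)) measurable_fst).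
  pose h (v : 'rV[R]_n * 'rV[R]_n) := (g v.2 `^ r * w v.1 v.2)%:E.
  have mh : measurable_fun setT h.
    apply/measurable_EFinP; apply: measurable_funM => //.
    by apply: measurable_fun_powR; exact: (measurableT_comp mg measurable_snd).
  have h0 v : 0 <= h v by rewrite lee_fin mulr_ge0 ?powR_ge0 ?JPhi_ge0.
  have hE s : \int[mu]_t h (s, t) = \int[lam]_(t in @cube R n) h (s, t).
    have mhs : measurable_fun setT (fun t => h (s, t)).
      exact: (measurableT_comp mh (measurable_pair1 s)).
    exact: (ge0_integral_mrestr lam (@measurable_cube R n) mhs (fun t => h0 (s, t))).
  have mhI : measurable_fun setT (fun s => \int[mu]_t h (s, t)).
    under eq_fun do rewrite hE.
    exact: (measurable_integral_slice lam (@measurable_cube R n) mh h0).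
  have := @integral_le_double_integral _ _ R mu g w (@cube R n) m K mg
    (fun t => f0 _) mw (fun s t => JPhi_ge0 Phi _ _) ae_cube
    (fun s cs => (hK z.1 s cs).1) m1 K0 (fun s cs => (hK z.1 s cs).2) mhI.
  have mge : measurable_fun setT (fun t => (g t)%:E) by exact/measurable_EFinP.
  have ge0 t : 0 <= (g t)%:E by rewrite lee_fin; exact: f0.
  rewrite (ge0_integral_mrestr lam (@measurable_cube R n) mge ge0).
  move=> /le_trans; apply; apply: lee_wpmul2l; first by rewrite lee_fin powR_ge0.
  have hle s : \int[mu]_t h (s, t) <= I (z, s).
    have mhs : measurable_fun setT (fun t => h (s, t)).
      exact: (measurableT_comp mh (measurable_pair1 s)).
    rewrite hE; exact: (ge0_subset_integral lam (@measurable_cube R n) measurableT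
      mhs (fun t _ => h0 (s, t)) (@subsetT _ _)).
  have ghI : measurable_fun setT (fun s => (g s `^ r)%:E * \int[mu]_t h (s, t)).
    apply: emeasurable_funM => //.
    by apply/measurable_EFinP; exact: measurable_fun_powR.
  have h0I s : 0 <= \int[mu]_t h (s, t) by exact: integral_ge0.
  have ghI0 s : 0 <= (g s `^ r)%:E * \int[mu]_t h (s, t).
    by rewrite mule_ge0// lee_fin powR_ge0.
  rewrite (ge0_integral_mrestr lam (@measurable_cube R n) ghI ghI0).
  apply: (@le_trans _ _ (\int[lam]_s ((g s `^ r)%:E * \int[mu]_t h (s, t)))).
    exact: (ge0_subset_integral lam (@measurable_cube R n) measurableT
      ghI (fun s _ => ghI0 s) (@subsetT _ _)).
  have mFIz : measurable_fun setT (fun s => F (shear Phi z s) * I (z, s)).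
    exact: (measurableT_comp mFI (measurable_pair1 z)).
  apply: (ge0_le_integral lam measurableT (fun s _ => ghI0 s) ghI mFIz).
  by move=> s _; apply: lee_wpmul2l; [rewrite lee_fin powR_ge0|exact: hle].
have mL : measurable_fun setT (fun z =>
    (\int[lam]_(t in @cube R n) (f (shear Phi z t))%:E) `^ (m + 1)).
  apply: (measurableT_comp (measurable_poweR _)).
  apply: (measurable_integral_slice lam (@measurable_cube R n)
    (h := fun u : ('rV[R]_n * 'rV[R]_n) * 'rV[R]_n => (f (shear Phi u.1 u.2))%:E)).
  - by apply/measurable_EFinP; apply: (measurableT_comp mf); exact: mshear.
  - by move=> u; rewrite lee_fin; exact: f0.
have K10 : 0 <= (K `^ (m - 1))%:E by rewrite lee_fin powR_ge0.
apply: (@le_trans _ _ (\int[lebesgue_rV2 R n]_z ((K `^ (m - 1))%:E * B z))).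
  apply: ge0_le_integral => //.
  - by move=> z _; exact: poweR_ge0.
  - exact: measurable_funeM.
rewrite (ge0_integralZl (lebesgue_rV2 R n) measurableT mB (fun z _ => B0 z) K10).
rewrite EFinM -muleA; apply: lee_wpmul2l => //.
exact: (integral_bilinear_shear Phi_smooth Phi_linear fib mF F0).
Qed.

End kernel.

(** * Absolute convergence and null sets *)

Section averaging_facts.
Local Open Scope ereal_scope.
Context (R : realType) (n : nat) (Phi : 'rV[R]_n * 'rV[R]_n -> 'rV[R]_n).
Hypothesis Phi_smooth : smooth Phi.
Variable f : 'rV[R]_n * 'rV[R]_n -> R.
Hypothesis mf : measurable_fun setT f.

Local Notation lam := (lebesgue_rV R n).
Local Notation lam2 := (lebesgue_rV2 R n).

(** Kept extended-real, so that its finiteness at [z] expresses convergence of the integral that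
    defines the operator. *)
Definition abs_averaging z := \int[lam]_(t in @cube R n) (`|f (shear Phi z t)|%R)%:E.

Let mfs : measurable_fun setT
  (fun u : ('rV[R]_n * 'rV[R]_n) * 'rV[R]_n => (f (shear Phi u.1 u.2))%:E).
Proof.
by apply/measurable_EFinP; exact: (measurableT_comp mf (measurable_shear Phi_smooth)).
Qed.

Lemma measurable_shear_slice z : measurable_fun setT (fun t => (f (shear Phi z t))%:E).
Proof. exact: (measurableT_comp mfs (measurable_pair1 z)). Qed.

Let mfabs z : measurable_fun setT (fun t => (`|f (shear Phi z t)|%R)%:E).
Proof. exact: (measurableT_comp (@abse_measurable R setT) (measurable_shear_slice z)). Qed.

Lemma measurable_abs_averaging : measurable_fun setT abs_averaging.
Proof.
apply: (measurable_integral_slice lam (@measurable_cube R n)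
  (h := fun u : ('rV[R]_n * 'rV[R]_n) * 'rV[R]_n => (`|f (shear Phi u.1 u.2)|%R)%:E)).
- exact: (measurableT_comp (@abse_measurable R setT) mfs).
- by move=> u; rewrite lee_fin.
Qed.

Lemma measurable_averaging : measurable_fun setT (averaging Phi f).
Proof.
pose g (u : ('rV[R]_n * 'rV[R]_n) * 'rV[R]_n) := (f (shear Phi u.1 u.2))%:E.
have mp : measurable_fun setT (fun z => \int[lam]_(t in @cube R n) (g^\+ (z, t))).
  exact: (measurable_integral_slice lam (@measurable_cube R n) (measurable_funepos mfs)
    (funepos_ge0 g)).
have mm : measurable_fun setT (fun z => \int[lam]_(t in @cube R n) (g^\- (z, t))).
  exact: (measurable_integral_slice lam (@measurable_cube R n) (measurable_funeneg mfs)
    (funeneg_ge0 g)).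
rewrite (_ : averaging Phi f = fun z => fine
    (\int[lam]_(t in @cube R n) (g^\+ (z, t)) - \int[lam]_(t in @cube R n) (g^\- (z, t)))).
  by apply: (measurableT_comp (fine_measurable measurableT)); exact: emeasurable_funB.
apply/funext => z; rewrite /averaging /Rintegral integralE.
by congr (fine (_ - _)); apply: eq_integral => t _; rewrite !(funeposE, funenegE).
Qed.

Lemma averaging_le z : (`|averaging Phi f z|%R)%:E <= abs_averaging z.
Proof.
have h := le_abse_integral lam (@measurable_cube R n)
  (measurable_funTS (measurable_shear_slice z)).
apply: le_trans h; rewrite /averaging /Rintegral.
(* [fine] sends an infinite integral to 0, which respects the bound. *)
by case: (\int[lam]_(t in @cube R n) (f (shear Phi z t))%:E) => //=; rewrite normr0 leey.
Qed.

Lemma integrable_averaging :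
  {ae lam2, forall z, abs_averaging z < +oo} ->
  {ae lam2, forall z, lam.-integrable (@cube R n) (fun t => (f (shear Phi z t))%:E)}.
Proof.
apply: filterS => z hz; apply/integrableP; split => //.
exact: measurable_funTS (measurable_shear_slice z).
Qed.

(** Integrating the indicator of [N] over all sheared points gives the integral over [x] of
    [lam2 N], which is zero; hence the inner integral vanishes for almost every [z]. *)
Lemma ae_shear (N : set ('rV[R]_n * 'rV[R]_n)) : measurable N -> lam2 N = 0 ->
  {ae lam2, forall z, {ae lam, forall t, ~ N (shear Phi z t)}}.
Proof.
move=> mN N0.
pose Q (v : 'rV[R]_n * ('rV[R]_n * 'rV[R]_n)) : \bar R := (\1_N v.2)%:E.
have m1 : measurable_fun setT (fun w : 'rV[R]_n * 'rV[R]_n => (\1_N w : R)%:E).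
  by apply/measurable_EFinP; exact: measurable_indic.
have mQ : measurable_fun setT Q by exact: (measurableT_comp m1 measurable_snd).
have Q0 v : 0 <= Q v by rewrite lee_fin.
have h := integral_shear_family Phi_smooth mQ Q0.
have mS : measurable_fun setT (fun u : ('rV[R]_n * 'rV[R]_n) * 'rV[R]_n =>
    (\1_N (shear Phi u.1 u.2) : R)%:E).
  exact: (measurableT_comp m1 (measurable_shear Phi_smooth)).
have S0 z t : 0 <= (\1_N (shear Phi z t) : R)%:E by rewrite lee_fin.
have mI : measurable_fun setT (fun z => \int[lam]_s (\1_N (shear Phi z s) : R)%:E).
  exact: (measurable_fun_fubini_tonelli_F (m2 := lam) _ mS (fun u => S0 u.1 u.2)).
have I0 z : 0 <= \int[lam]_s (\1_N (shear Phi z s) : R)%:E by exact: integral_ge0.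
have h0 : \int[lam2]_z `|\int[lam]_s (\1_N (shear Phi z s) : R)%:E| = 0.
  transitivity (\int[lam2]_z \int[lam]_s (\1_N (shear Phi z s) : R)%:E).
    by apply: eq_integral => z _; rewrite gee0_abs.
  rewrite [LHS]h; apply: integral0_eq => x _.
  by rewrite /Q /= integral_indic// setIT.
have /(ae_eq_integral_abs lam2 measurableT mI) := h0.
apply: filterS => z /(_ I) hz.
have mSz : measurable_fun setT (fun t => (\1_N (shear Phi z t) : R)%:E).
  exact: (measurableT_comp mS (measurable_pair1 z)).
have hz0 : \int[lam]_t `|(\1_N (shear Phi z t) : R)%:E| = 0.
  rewrite -[RHS]hz; apply: eq_integral => t _.
  by rewrite (gee0_abs (S0 z t)).
have /(ae_eq_integral_abs lam measurableT mSz) := hz0.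
apply: filterS => t /(_ I) + Nt; rewrite /= indicE mem_set//.
by move=> /eqP; rewrite eqe oner_eq0.
Qed.

Lemma abs_averaging_ae_le (M : R) : (0 <= M)%R ->
  {ae lam2, forall z, (`|f z| <= M)%R} ->
  {ae lam2, forall z, abs_averaging z <= (2 ^+ n * M)%:E}.
Proof.
move=> M0 [N [mN N0 hN]]; apply: filterS (ae_shear mN N0) => z hz.
apply: (@le_trans _ _ (\int[lam]_(t in @cube R n) (cst M%:E t))); last first.
  rewrite integral_cst; last exact: measurable_cube.
  by rewrite -[X in _ * X]/(lebesgue_rV R n (@cube R n)) lebesgue_cube -EFinM mulrC.
apply: (ae_ge0_le_integral (@measurable_cube R n)) => //.
- exact: measurable_funTS (mfabs z).
- apply: filterS hz => t Nt _; rewrite lee_fin; apply: contrapT => h.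
  exact/Nt/hN.
Qed.

End averaging_facts.

(** The norm of exponent [+oo] is an essential supremum only when the whole space has positive
    measure. *)
Lemma lebesgue_rV2_setT_gt0 (R : realType) n : (0 < lebesgue_rV2 R n setT)%E.
Proof.
apply: (@lt_le_trans _ _ (lebesgue_rV2 R n (@cube R n `*` @cube R n))).
  have -> : (lebesgue_rV2 R n (@cube R n `*` @cube R n) =
      lebesgue_rV R n (@cube R n) * lebesgue_rV R n (@cube R n))%E.
    by apply: product_measure1E; exact: measurable_cube.
  by rewrite lebesgue_cube -EFinM lte_fin mulr_gt0// exprn_gt0.
have mcc : measurable (@cube R n `*` @cube R n) by apply: measurableX; exact: measurable_cube.
exact: (le_measure (lebesgue_rV2 R n) (mem_set mcc) (mem_set measurableT) (@subsetT _ _)).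
Qed.

Lemma averaging_bounded_infty (R : realType) n (Phi : 'rV[R]_n * 'rV[R]_n -> 'rV[R]_n) :
  smooth Phi -> averaging_bounded Phi +oo%E +oo%E.
Proof.
move=> Phi_smooth; exists (2 ^+ n) => f hf.
have mf : measurable_fun setT f := set_mem (sub_Lfun_mfun hf).
have ffin : finite_norm (lebesgue_rV2 R n) +oo%E f := set_mem (sub_Lfun_finLfun hf).
have T0 := lebesgue_rV2_setT_gt0 R n.
pose M := fine ('N[lebesgue_rV2 R n]_+oo[EFin \o f])%E.
have M0 : 0 <= M by rewrite fine_ge0// Lnorm_ge0.
have ME : M%:E = ('N[lebesgue_rV2 R n]_+oo[EFin \o f])%E.
  by rewrite fineK// ge0_fin_numE//; exact: Lnorm_ge0.
have fM : {ae lebesgue_rV2 R n, forall z, `|f z| <= M}.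
  have := ess_sup_ge (lebesgue_rV2 R n) (abse \o (EFin \o f)).
  apply: filterS => z; rewrite -lee_fin ME unlock /Lnorm T0; exact.
have hA := abs_averaging_ae_le Phi_smooth mf M0 fM.
have Nle : ('N[lebesgue_rV2 R n]_+oo[EFin \o averaging Phi f] <= (2 ^+ n * M)%:E)%E.
  rewrite unlock /Lnorm T0; apply/ess_supP; apply: filterS hA => z.
  exact: le_trans (averaging_le Phi_smooth mf z).
split.
- apply: (integrable_averaging Phi_smooth mf); apply: filterS hA => z.
  by move/le_lt_trans; apply; rewrite ltry.
- apply/andP; split; apply: mem_set.
    exact: measurable_averaging.
  by rewrite /= /finite_norm (le_lt_trans Nle)// ltry.
- by rewrite -ME -EFinM.
Qed.

Lemma averaging_bounded_fin (R : realType) n (Phi : 'rV[R]_n * 'rV[R]_n -> 'rV[R]_n)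
    (N : nat) (r : R) :
  smooth Phi -> (forall x, linear (fun t => Phi (x, t))) ->
  (forall t c : 'rV[R]_n,
     ([set x | Phi (x, t) = c /\ JPhi Phi x t != 0] #<= `I_N)%card) ->
  (forall theta : R, 0 <= theta < 1 ->
     exists C : R, forall (x : 'rV[R]_n) (e : R), 0 < e ->
       (lebesgue_rV R n [set t | cube t /\ (JPhi Phi x t <= e)%R]
          <= (C * e `^ theta)%:E)%E) ->
  3 / 2 < r -> averaging_bounded Phi r%:E (2 * r)%:E.
Proof.
move=> Phi_smooth Phi_linear fib J_sublevel hr.
have r0 : 0 < r by lra.
(* [m + 1 = 2 r] is the target exponent and [(m + 1) / 2 = r] the source one; [r > 3/2] is
   [m > 2]. *)
have [|A A0 hA] := integral_averaging_powR_le Phi_smooth Phi_linear J_sublevel (m := 2 * r - 1) fib.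
  by lra.
have mE : 2 * r - 1 + 1 = 2 * r by ring.
have rE : (2 * r - 1 + 1) / 2 = r by rewrite mE mulrC mulKf.
rewrite rE mE in hA.
exists (A `^ (2 * r)^-1) => f hf.
have mf : measurable_fun setT f := set_mem (sub_Lfun_mfun hf).
have ffin : finite_norm (lebesgue_rV2 R n) r%:E f := set_mem (sub_Lfun_finLfun hf).
pose I : \bar R := (\int[lebesgue_rV2 R n]_z (`|f z| `^ r)%:E)%E.
have I0 : (0 <= I)%E by apply: integral_ge0 => z _; rewrite lee_fin powR_ge0.
have NE : ('N[lebesgue_rV2 R n]_(r%:E)[EFin \o f])%E = (I `^ r^-1)%E by rewrite unlock.
have Ifin : I \is a fin_num.
  rewrite ge0_fin_numE//; apply: (@lty_poweRy _ _ r^-1); first by rewrite gt_eqF ?invr_gt0.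
  by rewrite -NE.
pose i := fine I; have iE : i%:E = I by rewrite fineK.
have i0 : 0 <= i by rewrite fine_ge0.
have mnf : measurable_fun setT (fun z => `|f z|) by exact: measurableT_comp.
have {hA} := hA (fun z => `|f z|) mnf (fun z => normr_ge0 _).
rewrite -/I -iE -!EFinM -/(abs_averaging Phi f _).
set J := (X in (X <= _)%E) => hJ.
have mP : measurable_fun setT (fun z => abs_averaging Phi f z `^ (2 * r))%E.
  exact: (measurableT_comp (measurable_poweR _) (measurable_abs_averaging Phi_smooth mf)).
have hfin : {ae lebesgue_rV2 R n, forall z, abs_averaging Phi f z < +oo}%E.
  have hi : (lebesgue_rV2 R n).-integrable setT (fun z => abs_averaging Phi f z `^ (2 * r))%E.
    apply/integrableP; split => //.
    under eq_integral do rewrite gee0_abs ?poweR_ge0//.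
    by rewrite (le_lt_trans hJ)// ltry.
  apply: filterS (integrable_ae measurableT hi) => z /(_ Logic.I).
  rewrite ge0_fin_numE ?poweR_ge0//; apply: lty_poweRy.
  by rewrite gt_eqF// mulr_gt0.
have Nle : ('N[lebesgue_rV2 R n]_((2 * r)%:E)[EFin \o averaging Phi f] <=
    (A `^ (2 * r)^-1 * i `^ r^-1)%:E)%E.
  have -> : A `^ (2 * r)^-1 * i `^ r^-1 = (A * (i * i)) `^ (2 * r)^-1.
    rewrite powRM// ?mulr_ge0//; congr (_ * _).
    rewrite powRM// -powRD; last first.
      by apply/implyP; rewrite -mulr2n mulrn_eq0/= invr_eq0 mulf_eq0 pnatr_eq0/= gt_eqF.
    by congr (_ `^ _); rewrite invfM -mulrDl -mulr2n -[X in X *+ 2]mul1r -mulrnAl divff// mul1r.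
  rewrite -poweR_EFin unlock; apply: ge0_lee_poweR.
  - by rewrite invr_ge0 mulr_ge0// ltW.
  - by apply: integral_ge0 => z _; rewrite poweR_ge0.
  apply: le_trans hJ; apply: ge0_le_integral => //.
  - by move=> z _; rewrite poweR_ge0.
  - apply: (measurableT_comp (measurable_poweR _)).
    apply: (measurableT_comp (@abse_measurable R setT)).
    by apply/measurable_EFinP; exact: measurable_averaging.
  - move=> z _; apply: ge0_lee_poweR => //; first by rewrite mulr_ge0// ltW.
    exact: averaging_le.
split.
- exact: (integrable_averaging Phi_smooth mf).
- apply/andP; split; apply: mem_set.
    exact: measurable_averaging.
  by rewrite /= /finite_norm (le_lt_trans Nle)// ltry.
- by rewrite NE -iE poweR_EFin -EFinM.
Qed.

Theorem theorem2 (R : realType) (n : nat)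
    (Phi : 'rV[R]_n * 'rV[R]_n -> 'rV[R]_n)
    (Phi_smooth : smooth Phi)
    (Phi_linear : forall x, linear (fun t => Phi (x, t)))
    (Phi_fibers : exists N : nat, forall t c : 'rV[R]_n,
       ([set x | Phi (x, t) = c /\ JPhi Phi x t != 0] #<= `I_N)%card)
    (J_sublevel : forall theta : R, 0 <= theta < 1 ->
       exists C : R, forall (x : 'rV[R]_n) (e : R), 0 < e ->
         (lebesgue_rV R n [set t | cube t /\ (JPhi Phi x t <= e)%R]
            <= (C * e `^ theta)%:E)%E)
    (p q : \bar R) (s : R)
    (s01 : 0 <= s < 1)
    (pE : (p^-1)%E = (s * (2 / 3))%:E)
    (qE : (q^-1)%E = (s * (1 / 3))%:E) :
  averaging_bounded Phi p q.
Proof.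
have [N fib] := Phi_fibers.
have pinvE : p = ((s * (2 / 3))%:E^-1)%E by rewrite -pE inveK.
have qinvE : q = ((s * (1 / 3))%:E^-1)%E by rewrite -qE inveK.
(* The extended inverse of 0 is [+oo], so [s = 0] is the endpoint [(0, 0)]. *)
rewrite pinvE qinvE; have [s0|s0] := eqVneq s 0.
  by rewrite s0 !mul0r inve0; exact: averaging_bounded_infty.
have sgt0 : 0 < s by rewrite lt_neqAle eq_sym s0; case/andP: s01.
have slt1 : s < 1 by case/andP: s01.
(* With [r = 3 / (2 s)] the pair is [p = r] and [q = 2 r], and [s < 1] becomes [r > 3/2]. *)
have -> : ((s * (2 / 3))%:E^-1)%E = (3 / (2 * s))%:E.
  by rewrite inver gt_eqF ?mulr_gt0//; congr _%:E; field.
have -> : ((s * (1 / 3))%:E^-1)%E = (2 * (3 / (2 * s)))%:E.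
  by rewrite inver gt_eqF ?mulr_gt0//; congr _%:E; field.
apply: (averaging_bounded_fin Phi_smooth Phi_linear fib J_sublevel).
rewrite ltr_pdivlMr ?mulr_gt0//; lra.
Qed.
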